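(* Let $p$ be a prime, $q=p^a$, and let $f\in\mathbf{F}_q[x_1,\ldots,x_n]$ ($n\ge1$) have degree $d$ with degree-$d$ homogeneous component $f^{(d)}$. Let $b$, $M$, $\pi$, $\tilde{\Omega}_0$, $\epsilon$, the complex $(\Omega^{\cdot}_{C(b)},\pi^\epsilon D)$ and the monomials $x^{\mu_i}$ be as defined in the context. Suppose $\{\partial f^{(d)}/\partial x_i\}_{i=1}^n$ form a regular sequence in $\mathbf{F}_q[x_1,\ldots,x_n]$. Then (1) $H^i(\Omega^{\cdot}_{C(b)},\pi^\epsilon D)=0$ if $i\neq n$; (2) the cohomology classes $[x^{\mu_i}\,dx_1\wedge\cdots\wedge dx_n]$, $i=1,\ldots,(d-1)^n$, form a basis for $H^n(\Omega^{\cdot}_{C(b)},\pi^\epsilon D)$ as an $\tilde{\Omega}_0$-vector space.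
   Context: Fields. Let $\zeta_p$ be a primitive $p$-th root of unity, $\Omega_1=\mathbf{Q}_p(\zeta_p)$, $K$ the unramified extension of $\mathbf{Q}_p$ of degree $a$, $\Omega_0=K(\zeta_p)$, and $\Omega$ the completion of an algebraic closure of $\Omega_0$, with additive valuation $\mathrm{ord}$ normalized by $\mathrm{ord}\,p=1$. Let $\tau$ be the automorphism of $K$ over $\mathbf{Q}_p$ lifting the Frobenius $x\mapsto x^p$ of $\mathbf{F}_q$. Constants. Let $b$ be a positive rational number with $b<p/(p-1)$, and let $M$ be a positive integer such that $Mb/p$ and $Md/(p-1)$ are integers. Let $\pi\in\Omega$ satisfy $\pi^{Md}=p$, and let $\tilde{\Omega}_0=\Omega_0(\pi)$; $\pi$ is a uniformizer of its ring of integers $\mathcal{O}_{\tilde{\Omega}_0}$. Put $\epsilon=Mb(d-1)-Md/(p-1)$; it is assumed that $b$ is such that $\epsilon$ is a nonnegative integer. Let $\gamma\in\Omega_1$ be a solution of $\sum_{i=0}^\infty t^{p^i}/p^i=0$ with $\mathrm{ord}\,\gamma=1/(p-1)$, and put $\gamma_l=\sum_{i=0}^l\gamma^{p^i}/p^i$. Function space. For $u=(u_1,\ldots,u_n)\in\mathbf{N}^n$ ($\mathbf{N}$ includes $0$) let $|u|=u_1+\cdots+u_n$ and $$C(b)=\Bigl\{\sum_{u\in\mathbf{N}^n}A_u\pi^{Mb|u|}x^u\ \Big|\ A_u\in\tilde{\Omega}_0,\ A_u\to0\text{ as }u\to\infty\Bigr\}.$$ Operators. Let $\hat f=\sum_u\hat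 a_u x^u\in K[x_1,\ldots,x_n]$ be the Teichmüller lifting of $f$ (i.e. $(\hat a_u)^q=\hat a_u$ and $\hat f$ reduces to $f$ modulo $p$), and $\hat f_i=\partial\hat f/\partial x_i$. For $i=1,\ldots,n$ put $$H_i=\sum_{l=0}^\infty\gamma_l p^l x_i^{p^l-1}\hat f_i^{\tau^l}(x_1^{p^l},\ldots,x_n^{p^l}),\qquad D_i=\frac{\partial}{\partial x_i}+H_i,$$ where $\hat f_i^{\tau^l}$ is obtained by applying $\tau^l$ to the coefficients of $\hat f_i$, and $H_i$ acts by multiplication. For $b<p/(p-1)$ one has $H_i\in C(b)$ and $D_i$ acts on $C(b)$. Complex. Let $\Omega^k_{C(b)}=\bigoplus_{1\le i_1<\cdots<i_k\le n}C(b)\,dx_{i_1}\wedge\cdots\wedge dx_{i_k}$, with differential $D:\Omega^k_{C(b)}\to\Omega^{k+1}_{C(b)}$ given by $$D(\xi\,dx_{i_1}\wedge\cdots\wedge dx_{i_k})=\Bigl(\sum_{i=1}^nD_i(\xi)\,dx_i\Bigr)\wedge dx_{i_1}\wedge\cdots\wedge dx_{i_k}.$$ $(\Omega^{\cdot}_{C(b)},\pi^\epsilon D)$ is the complex with differential $\pi^\epsilon D$. Monomials. Let $\phi_{f^{(d)}}$ be the differential $\omega\mapsto df^{(d)}\wedge\omega$ on the complex $\Omega^{\cdot}_{\mathbf{F}_q[x_1,\ldots,x_n]/\mathbf{F}_q}$ of algebraic differential forms. Under the regular sequence hypothesis, $\dim_{\mathbf{F}_q}H^n(\Omega^{\cdot}_{\mathbf{F}_q[x_1,\ldots,x_n]/\mathbf{F}_q},\phi_{f^{(d)}})=(d-1)^n$.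 Fix monomials $x^{\mu_i}$, $i=1,\ldots,(d-1)^n$, in $x_1,\ldots,x_n$ such that the classes $[x^{\mu_i}\,dx_1\wedge\cdots\wedge dx_n]$ form an $\mathbf{F}_q$-basis of this space (equivalently, the $x^{\mu_i}$ form a basis of $\mathbf{F}_q[x_1,\ldots,x_n]/(\partial f^{(d)}/\partial x_1,\ldots,\partial f^{(d)}/\partial x_n)$). *)

(* Defs.v *)
From HB Require Import structures.
From mathcomp Require Import all_boot all_order all_algebra all_field.
From mathcomp Require Import boolp functions.
From mathcomp Require Import zify mpoly.

Set Implicit Arguments.
Unset Strict Implicit.
Unset Printing Implicit Defensive.

Import Order.TTheory GRing.Theory Num.Theory.
Local Open Scope ring_scope.

Section RegularSequence.
Variables (R : comNzRingType) (n : nat) (s : 'I_n -> R).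

Definition in_ideal (k : nat) (g : R) : Prop :=
  exists c : 'I_n -> R, g = \sum_(j < n | (j < k)%N) c j * s j.

Definition regular_sequence : Prop :=
  (forall (i : 'I_n) (g : R), in_ideal i (s i * g) -> in_ideal i g)
  /\ ~ in_ideal n 1.

End RegularSequence.

(* A form is given by its coefficients: [w S] is the coefficient of
   dx_{i_1} /\ ... /\ dx_{i_k} where S = {i_1 < ... < i_k}.  The complexes
   below have coefficients in the subspace of V cut out by the predicate C,
   and homogeneous forms are the families supported on the k-subsets. *)
Section Forms.
Variables (R : comNzRingType) (V : lmodType R) (n : nat) (C : V -> Prop).

Definition diff_form := {ffun {set 'I_n} -> V}.

Definition is_form (k : nat) (w : diff_form) : Prop :=
  forall S : {set 'I_n}, if #|S| == k then C (w S) else w S = 0.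

(* v dx_1 /\ ... /\ dx_n *)
Definition top_form (v : V) : diff_form :=
  [ffun S : {set 'I_n} => if S == setT then v else 0].

(* xi dx_S |-> (\sum_i D_i(xi) dx_i) /\ dx_S; moving dx_i into its place
   inside dx_S costs one sign for each j in S with j < i. *)
Definition wedge_diff (D : 'I_n -> V -> V) (w : diff_form) : diff_form :=
  [ffun S : {set 'I_n} =>
    \sum_(i in S) (-1) ^+ #|[set j in S | (j < i)%N]| *: D i (w (S :\ i))].

Variable delta : diff_form -> diff_form.

Definition cocycle (k : nat) (w : diff_form) : Prop :=
  is_form k w /\ delta w = 0.

Definition coboundary (k : nat) (w : diff_form) : Prop :=
  match k with
  | 0 => w = 0
  | k'.+1 => exists2 e, is_form k' e & w = delta e
  end.

Definition cohomology_vanishes (k : nat) : Prop :=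
  forall w, cocycle k w -> coboundary k w.

Definition cohomology_basis (k m : nat) (e : 'I_m -> diff_form) : Prop :=
  [/\ forall i, cocycle k (e i),
      forall c : 'I_m -> R,
        coboundary k (\sum_(i < m) c i *: e i) -> forall i, c i = 0
    & forall w, cocycle k w ->
        exists c : 'I_m -> R, coboundary k (w - \sum_(i < m) c i *: e i)].

End Forms.

(* Additive valuations.  The value of [ord] at 0 is irrelevant: 0 is
   treated separately everywhere, as an element of infinite valuation. *)
Section Valuation.
Variables (p : nat) (L : fieldType) (ord : L -> rat).

Definition ord_ge (r : rat) (x : L) : Prop := x = 0 \/ r <= ord x.

Definition ord_cvg (s : nat -> L) (l : L) : Prop :=
  forall r, exists k, forall i, (k <= i)%N -> ord_ge r (s i - l).

Definition ord_cauchy (s : nat -> L) : Prop :=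
  forall r, exists k, forall i j,
    (k <= i)%N -> (k <= j)%N -> ord_ge r (s i - s j).

Definition ord_complete : Prop :=
  forall s, ord_cauchy s -> exists l, ord_cvg s l.

Record padic_valuation : Prop := PadicValuation {
  ordM : forall x y, x != 0 -> y != 0 -> ord (x * y) = ord x + ord y;
  ordD : forall x y, x != 0 -> y != 0 -> x + y != 0 ->
    Num.min (ord x) (ord y) <= ord (x + y);
  p_neq0 : p%:R != 0 :> L;
  ord_p : ord p%:R = 1
}.

(* [padic_valuation] forces [ord] to be the p-adic valuation on the rational
   numbers, so this says that (L, ord) is the p-adic completion of Q. *)
Record is_Qp : Prop := IsQp {
  Qp_valuation : padic_valuation;
  Qp_complete : ord_complete;
  Qp_dense : forall (x : L) (r : rat), exists t : rat, ord_ge r (x - ratr t)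
}.

End Valuation.

Section Fields.
Variables (Qp : fieldType) (L : fieldExtType Qp) (ord : L -> rat).
Variable K : {subfield L}.

(* The residue field is finite, so only the ramification index matters;
   the valuation group of Qp is the group of integers. *)
Definition unramified : Prop :=
  forall x : L, x \in K -> x != 0 -> ord x \is a Num.int.

Variables (F : finFieldType) (red : L -> F).

(* [red], restricted to the valuation ring of K, is a surjective ring morphism
   onto F whose kernel is the maximal ideal. *)
Record residue_map : Prop := ResidueMap {
  red1 : red 1 = 1;
  redD : forall x y, x \in K -> y \in K -> ord_ge ord 0 x -> ord_ge ord 0 y ->
    red (x + y) = red x + red y;
  redM : forall x y, x \in K -> y \in K -> ord_ge ord 0 x -> ord_ge ord 0 y ->
    red (x * y) = red x * red y;
  red_eq0 : forall x, x \in K -> ord_ge ord 0 x ->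
    (red x = 0 <-> (x = 0 \/ 0 < ord x));
  red_surj : forall c : F, exists x, [/\ x \in K, ord_ge ord 0 x & red x = c]
}.

Definition lifts_Frobenius (p : nat) (tau : 'End(L)) : Prop :=
  kAut 1 K tau
  /\ forall x, x \in K -> ord_ge ord 0 x -> red (tau x) = red x ^+ p.

Definition Teichmuller_lift (n : nat) (f : {mpoly F[n]}) (fhat : {mpoly L[n]}) :
    Prop :=
  forall u, [/\ fhat@_u \in K, fhat@_u ^+ #|F| = fhat@_u & red fhat@_u = f@_u].

End Fields.

Definition gammal (L : fieldType) (p : nat) (gamma : L) (l : nat) : L :=
  \sum_(i < l.+1) gamma ^+ (p ^ i) / p%:R ^+ i.

Section Operators.
Variables (Qp : fieldType) (L : fieldExtType Qp) (ord : L -> rat) (n : nat).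

(* Formal power series \sum_u xi_u x^u, as a vector space over L. *)
Definition series := 'X_{1..n} -> L^o.

Definition monomial (m : 'X_{1..n}) : series := fun u => (u == m)%:R.

Definition series_deriv (i : 'I_n) (xi : series) : series :=
  fun u => xi (u + U_(i))%MM *+ (u i).+1.

Definition series_mul (g h : series) : series := fun u =>
  \sum_(k : 'X_{1..n < (mdeg u).+1, (mdeg u).+1} | u == (k.1 + k.2)%MM)
    (g k.1 : L) * h k.2.

(* M * b is a positive integer in the intended setting; A_u -> 0 is along the
   cofinite filter of N^n, i.e. as |u| -> oo. *)
Definition Cb (M : nat) (b : rat) (pi : L) (xi : series) : Prop :=
  exists2 A : 'X_{1..n} -> L,
    forall r, exists k, forall u, (k <= mdeg u)%N -> ord_ge ord r (A u)
  & forall u, xi u = A u * pi ^+ (Num.truncn (M%:R * b) * mdeg u).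

Variables (p : nat) (gamma : L) (tau : L -> L) (fhat : {mpoly L[n]}).

Definition Hterm (i : 'I_n) (l : nat) : {mpoly L[n]} :=
  (gammal p gamma l * p%:R ^+ l) *:
    ('X_i ^+ (p ^ l).-1 *
     (map_mpoly (iter l tau) fhat^`M(i) \mPo [tuple 'X_j ^+ (p ^ l) | j < n])).

(* H_i = \sum_l Hterm i l, coefficient by coefficient.  The sum is infinite but
   only the terms with l <= u_i can contain x^u, see [Hterm_coef0]. *)
Definition Hseries (i : 'I_n) : series :=
  fun u => \sum_(l < (u i).+1) (Hterm i l)@_u.

Definition Dop (i : 'I_n) (xi : series) : series :=
  series_deriv i xi + series_mul (Hseries i) xi.

Lemma Hterm_coef0 (i : 'I_n) (l : nat) (u : 'X_{1..n}) :
  (1 < p)%N -> (u i < l)%N -> (Hterm i l)@_u = 0.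
Proof.
move=> p1 ul; rewrite /Hterm mcoeffZ mpolyXn.
set q := comp_mpoly _ _; rewrite ['X_[_] * _]mulrC.
have [|/memN_msupp_eq0->] := boolP (u \in msupp (q * 'X_[U_(i) *+ (p ^ l).-1]));
  last by rewrite mulr0.
rewrite (perm_mem (msuppMX _ _)) => /mapP[m _ uE]; exfalso; move: ul.
rewrite uE mnmDE mulmnE mnm1E eqxx mul1n.
by have := ltn_expl l p1; case: (p ^ l)%N => // k; lia.
Qed.

End Operators.

(* Main.v *)
Require Import Defs.
From HB Require Import structures.
From mathcomp Require Import all_boot all_order all_algebra all_field.
From mathcomp Require Import boolp functions.
From mathcomp Require Import zify ring lra mpoly.

Set Implicit Arguments.
Unset Strict Implicit.
Unset Printing Implicit Defensive.

Import Order.TTheory GRing.Theory Num.Theory.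
Local Open Scope ring_scope.

(* Rescaling by [gamma], the differential becomes wedge product with the
   1-form of the partial derivatives of the leading form of [fhat], up to a
   perturbation that is small for the norm defining C(b).  Modulo p this leading
   part is the Koszul complex of a regular sequence, graded by finite-dimensional
   pieces, so linear algebra over F_q gives a homotopy between the identity and a
   projection onto the span of the x^mu_i dx_1 ... dx_n.  Its matrix entries are
   lifted to the ring of integers of K; the lift is a homotopy up to an error of
   positive valuation, which successive approximation removes because L is
   complete.  No residue field of L is needed: only that of K is used. *)

(** * Valuations *)

(** Since ord pi = 1/(Md), C(b) consists of the series with ord(xi_u) - beta |u| tending to
    infinity, where beta = b/d. The scaling is by [gamma] rather than by a power of [pi] so that the
    term l = 0 of gamma^-1 H_i is a partial derivative of [fhat]: its coefficients lie in K and can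
    be compared with F_q. Multiplication by an integral form of degree d-1 loses beta (d-1) in this
    norm, and every other contribution must lose less by a uniform amount. Lower-degree terms of
    [fhat] lose at least beta less. Terms l >= 1 lose at least p/(p-1) - b less, which is where b <
    p/(p-1) enters. For gamma^-1 d/dx_i the condition 1/(p-1) <= beta (d-1) suffices, and this is
    eps >= 0. Errors of the lift from F_q have valuation at least 1 because K is unramified.
    Uniformity over the infinitely many graded pieces costs nothing: whatever homotopy is chosen
    over F_q, its lifted entries are integral, so the lifted operators never increase the norm. *)

Section ValuationTheory.
Variables (p : nat) (L : fieldType) (ord : L -> rat).
Hypothesis hord : padic_valuation p ord.
Implicit Types (r t : rat) (x y : L).

Lemma ord1 : ord 1 = 0.
Proof.
have := ordM hord (oner_neq0 L) (oner_neq0 L).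
by rewrite mulr1 => /eqP; rewrite -subr_eq subrr => /eqP.
Qed.

Lemma ordX x k : x != 0 -> ord (x ^+ k) = ord x *+ k.
Proof.
move=> x0; elim: k => [|k IH]; first by rewrite expr0 ord1.
by rewrite exprS (ordM hord) ?expf_neq0 // IH mulrS.
Qed.

Lemma ordV x : x != 0 -> ord x^-1 = - ord x.
Proof.
move=> x0; have := ordM hord x0 (invr_neq0 x0).
by rewrite divff // ord1 => /esym/eqP; rewrite addrC addr_eq0 => /eqP.
Qed.

Lemma ord_opp x : ord (- x) = ord x.
Proof.
have [->|x0] := eqVneq x 0; first by rewrite oppr0.
have N1 : (-1 : L) != 0 by rewrite oppr_eq0 oner_eq0.
rewrite -mulN1r (ordM hord) //; have := ordX 2 N1.
by rewrite sqrrN expr1n ord1 => /esym/eqP; rewrite mulrn_eq0 /= => /eqP->; rewrite add0r.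
Qed.

Lemma ord_ge0 r : ord_ge ord r 0. Proof. by left. Qed.
Hint Resolve ord_ge0 : core.

Lemma ord_geW r t x : t <= r -> ord_ge ord r x -> ord_ge ord t x.
Proof. by move=> tr [->|rx]; [left|right; apply: le_trans rx]. Qed.

Lemma ord_geN r x : ord_ge ord r x -> ord_ge ord r (- x).
Proof. by case=> [->|rx]; [left; rewrite oppr0|right; rewrite ord_opp]. Qed.

Lemma ord_geD r x y : ord_ge ord r x -> ord_ge ord r y -> ord_ge ord r (x + y).
Proof.
case=> [->|rx]; first by rewrite add0r.
case=> [->|ry]; first by rewrite addr0; right.
have [->|x0] := eqVneq x 0; first by rewrite add0r; right.
have [->|y0] := eqVneq y 0; first by rewrite addr0; right.
have [->//|xy0] := eqVneq (x + y) 0.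
by right; apply: le_trans (ordD hord x0 y0 xy0); rewrite le_min rx.
Qed.

Lemma ord_geB r x y : ord_ge ord r x -> ord_ge ord r y -> ord_ge ord r (x - y).
Proof. by move=> rx ry; apply: ord_geD => //; apply: ord_geN. Qed.

Lemma ord_geM r t x y :
  ord_ge ord r x -> ord_ge ord t y -> ord_ge ord (r + t) (x * y).
Proof.
case=> [->|rx]; first by rewrite mul0r.
case=> [->|ry]; first by rewrite mulr0.
have [->|x0] := eqVneq x 0; first by rewrite mul0r.
have [->|y0] := eqVneq y 0; first by rewrite mulr0.
by right; rewrite (ordM hord) // lerD.
Qed.

Lemma ord_geM0 r x y :
  ord_ge ord 0 x -> ord_ge ord r y -> ord_ge ord r (x * y).
Proof. by move=> x0 yr; rewrite -[r]add0r; apply: ord_geM. Qed.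

Lemma ord_ge_sum I (s : seq I) (P : pred I) (G : I -> L) r :
  (forall i, P i -> ord_ge ord r (G i)) -> ord_ge ord r (\sum_(i <- s | P i) G i).
Proof. by move=> h; apply: big_ind => // x y; apply: ord_geD. Qed.

Lemma ord_ge_refl x : ord_ge ord (ord x) x. Proof. by right. Qed.

Lemma ord_ge1 : ord_ge ord 0 1.
Proof. by right; rewrite ord1. Qed.
Hint Resolve ord_ge1 : core.

Lemma ord_ge_nat k : ord_ge ord 0 k%:R.
Proof. by elim: k => [|k IH] //; rewrite mulrS; apply: ord_geD. Qed.

Lemma ord_geMn r x k : ord_ge ord r x -> ord_ge ord r (x *+ k).
Proof. by move=> rx; rewrite -mulr_natl; apply: ord_geM0 => //; apply: ord_ge_nat. Qed.

Lemma ord_geX x k : ord_ge ord 0 x -> ord_ge ord 0 (x ^+ k).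
Proof. by move=> x0; elim: k => [|k IH] //; rewrite exprS; apply: ord_geM0. Qed.

Lemma ord_ge_sign r k x : ord_ge ord r x -> ord_ge ord r ((-1) ^+ k * x).
Proof.
by apply: ord_geM0; apply/ord_geX/ord_geN.
Qed.

Lemma ord_ge_dvd k m : (p ^ k %| m)%N -> ord_ge ord k%:R m%:R.
Proof.
move=> /dvdnP[c ->]; rewrite natrM; apply: ord_geM0; first exact: ord_ge_nat.
by right; rewrite natrX ordX ?(p_neq0 hord) // (ord_p hord).
Qed.

Lemma ord_ge_lt_eq0 r x : ord_ge ord r x -> ord x < r -> x = 0.
Proof. by case=> // rx; rewrite ltNge rx. Qed.

Lemma ord_ge_arch (r eta : rat) x : 0 < eta ->
  (forall k : nat, ord_ge ord (r + k%:R * eta) x) -> x = 0.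
Proof.
move=> eta0 h.
pose k := Num.bound (`|(ord x - r) / eta| + 1).
apply: (ord_ge_lt_eq0 (h k)); rewrite -ltrBlDl -ltr_pdivrMr //.
have := archi_boundP (ltW (ltr_wpDl (normr_ge0 ((ord x - r) / eta)) ltr01)).
by apply: le_lt_trans; rewrite (le_trans (ler_norm _)) // lerDl.
Qed.

(** Comparing valuations in x^k = x gives (k-1) ord x = 0 for nonzero x. *)
Lemma ord_root_unity x k : (1 < k)%N -> x ^+ k = x -> ord_ge ord 0 x.
Proof.
move=> k1; have [->//|x0] := eqVneq x 0; move=> /(congr1 ord).
rewrite ordX //; case: k k1 => // k k1 /eqP; rewrite mulrS -[X in _ == X]addr0.
rewrite (inj_eq (addrI _)) mulrn_eq0; case/orP => [/eqP|/eqP] E; first by lia.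
by right; rewrite E.
Qed.

Lemma ord_root_unity_eq0 x k : (1 < k)%N -> x ^+ k = x -> x = 0 \/ 0 < ord x -> x = 0.
Proof.
move=> k1 xk [//|]; have [->//|x0] := eqVneq x 0; move: xk => /(congr1 ord).
rewrite ordX //; case: k k1 => // k k1 /eqP; rewrite mulrS -[X in _ == X]addr0.
rewrite (inj_eq (addrI _)) mulrn_eq0; case/orP => [/eqP|/eqP] E; first by lia.
by rewrite E ltxx.
Qed.

Lemma ord_cvg_uniq (s : nat -> L) (l l' : L) :
  ord_cvg ord s l -> ord_cvg ord s l' -> l = l'.
Proof.
move=> h h'; apply/eqP; rewrite -subr_eq0; apply/eqP.
apply: (@ord_ge_arch 0 1) => // k; rewrite mulr1 add0r.
have [m hm] := h k%:R; have [m' hm'] := h' k%:R.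
have -> : l - l' = (s (m + m')%N - l') - (s (m + m')%N - l) by ring.
by apply: ord_geB; [apply: hm'|apply: hm]; lia.
Qed.

End ValuationTheory.

Arguments ord_ge0 {L ord r}.
#[export] Hint Resolve ord_ge0 : core.

(** * Completeness of finite extensions of a complete field *)

Section Completeness.
Variables (p : nat) (Qp : fieldType) (L : fieldExtType Qp) (ord : L -> rat).
Hypothesis hord : padic_valuation p ord.
Hypothesis hQp : ord_complete (fun c : Qp => ord c%:A).

Definition complete_on (U : {vspace L}) : Prop :=
  forall s : nat -> L, (forall k, s k \in U) -> ord_cauchy ord s ->
    exists2 l, l \in U & ord_cvg ord s l.

(* Otherwise [W] would contain a sequence converging to [- e], hence [e]. *)
Lemma complete_on_dist (W : {vspace L}) (e : L) : complete_on W -> e \notin W ->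
  exists r, forall w, w \in W -> ~ ord_ge ord r (e + w).
Proof.
move=> hW eW; apply: contrapT => hn.
have /choice[s hs] : forall k : nat, exists w, w \in W /\ ord_ge ord k%:R (e + w).
  move=> k; apply: contrapT => hk; apply: hn; exists k%:R => w wW ge.
  by apply: hk; exists w.
have cv : ord_cvg ord s (- e).
  move=> r; exists (Num.bound `|r|) => i hi; rewrite opprK addrC.
  apply: ord_geW (hs i).2; apply: le_trans (ler_norm r) _.
  by rewrite (le_trans (ltW (archi_boundP (normr_ge0 r)))) // ler_nat.
have cs : ord_cauchy ord s.
  move=> r; have [k hk] := cv r; exists k => i j hi hj.
  have -> : s i - s j = (s i - - e) - (s j - - e) by ring.
  by apply: (ord_geB hord); apply: hk.
have [l lW lcv] := hW s (fun k => (hs k).1) cs.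
by move/negP: eW; apply; rewrite -memvN (ord_cvg_uniq hord cv lcv).
Qed.

(** The vector [e] stays at a positive distance from [W], so the size of w + c e controls the size
    of c. Hence along a Cauchy sequence the coefficients of [e] are Cauchy, and then so are the
    components in [W]. *)
Lemma complete_on_add (W : {vspace L}) (e : L) :
  complete_on W -> complete_on (W + <[e]>)%VS.
Proof.
move=> hW; have [eW|eW] := boolP (e \in W).
  by move: eW; rewrite memvE => /addv_idPl ->.
have [r0 hr0] := complete_on_dist hW eW.
(* If the valuation of c were below r - r0, dividing by c would bring [e] closer to [W] than [r0]
   allows. *)
have key w c r : w \in W -> ord_ge ord r (w + c *: e) -> ord_ge ord (r - r0) (c%:A : L).
  move=> wW; have [->|c0] := eqVneq c 0; first by move=> _; rewrite scale0r; left.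
  have cA0 : c%:A != 0 :> L by rewrite scaler_eq0 negb_or c0 oner_neq0.
  move=> ge; right; rewrite leNgt; apply/negP => lt.
  apply: (hr0 (c^-1 *: w)); first exact: memvZ.
  have -> : e + c^-1 *: w = (c%:A)^-1 * (w + c *: e).
    have cE : c^-1%:A * c%:A = 1 :> L by rewrite mulr_algl scalerA mulVf // scale1r.
    have -> : (c%:A)^-1 = c^-1%:A :> L.
      by apply: (mulIf cA0); rewrite mulVf // cE.
    by rewrite mulr_algl scalerDr scalerA mulVf // scale1r addrC.
  apply: ord_geW (ord_geM hord (ord_ge_refl _ _) ge).
  by rewrite (ordV hord) //; lra.
move=> s sU cs.
have /choice[f hf] : forall k, exists wc : L * Qp, wc.1 \in W /\ s k = wc.1 + wc.2 *: e.
  move=> k; have /memv_addP[w wW [v /vlineP[c ->] ->]] := sU k.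
  by exists (w, c).
have cc : ord_cauchy (fun c : Qp => ord c%:A) (fun k => (f k).2).
  move=> r; have [k hk] := cs (r + r0); exists k => i j hi hj.
  suff: ord_ge ord r (((f i).2 - (f j).2)%:A : L).
    case=> [/eqP|]; last by right.
    by rewrite scaler_eq0 oner_eq0 orbF => /eqP->; left.
  rewrite -[r](addrK r0); apply: (key ((f i).1 - (f j).1)).
    by rewrite memvB //; [case: (hf i)|case: (hf j)].
  have -> : (f i).1 - (f j).1 + ((f i).2 - (f j).2) *: e = s i - s j.
    by rewrite (hf i).2 (hf j).2 scalerBl; ring.
  exact: hk.
have [c hc] := hQp cc.
have hce r : exists k, forall i, (k <= i)%N -> ord_ge ord r (((f i).2 - c) *: e).
  have [k hk] := hc (r - ord e); exists k => i /hk h.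
  rewrite -mulr_algl; have -> : r = (r - ord e) + ord e by lra.
  apply: (ord_geM hord) (ord_ge_refl _ _); case: h => [->|]; last by right.
  by rewrite scale0r.
have cw : ord_cauchy ord (fun k => (f k).1).
  move=> r; have [k hk] := cs r; have [k' hk'] := hce r.
  exists (k + k')%N => i j hi hj.
  have -> : (f i).1 - (f j).1 =
      (s i - s j) - (((f i).2 - c) *: e - ((f j).2 - c) *: e).
    by rewrite (hf i).2 (hf j).2 !scalerBl; ring.
  apply: (ord_geB hord); first by apply: hk; lia.
  by apply: (ord_geB hord); apply: hk'; lia.
have [l lW hl] := hW _ (fun k => (hf k).1) cw.
exists (l + c *: e); first by rewrite memv_add // memvZ // memv_line.
move=> r; have [k hk] := hl r; have [k' hk'] := hce r.
exists (k + k')%N => i hi.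
have -> : s i - (l + c *: e) = ((f i).1 - l) + ((f i).2 - c) *: e.
  by rewrite (hf i).2 scalerBl; ring.
by apply: (ord_geD hord); [apply: hk|apply: hk']; lia.
Qed.

Lemma fieldExt_ord_complete : ord_complete ord.
Proof.
suff h : complete_on fullv.
  by move=> s cs; have [//|l _ hl] := h s _ cs; [move=> k; rewrite memvf|exists l].
rewrite -(span_basis (vbasisP fullv)).
elim: (vbasis fullv : seq L) => [|e es IH].
  move=> s hs _; exists 0; first exact: mem0v.
  by move=> r; exists 0%N => i _; have := hs i; rewrite span_nil memv0 => /eqP->; rewrite subrr.
by rewrite span_cons addvC; apply: complete_on_add.
Qed.

End Completeness.

(** * Koszul complexes *)

Section WedgeSign.
Variable n : nat.
Implicit Types (S : {set 'I_n}) (i j : 'I_n).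

(** The exponent of the sign in [wedge_diff]. *)
Definition below S i : nat := #|[set k in S | (k < i)%N]|.

Lemma below_D1 S i j : (i <= j)%N -> below (S :\ j) i = below S i.
Proof.
move=> ij; apply: eq_card => k; rewrite !inE -andbA; case: eqP => //= ->.
by rewrite ltnNge ij andbF.
Qed.

Lemma belowD1 S i j : j \in S -> (j < i)%N -> below S i = (below (S :\ j) i).+1.
Proof.
move=> jS ji; rewrite /below (cardsD1 j) inE jS ji add1n; congr _.+1.
by apply: eq_card => k; rewrite !inE andbA.
Qed.

End WedgeSign.

Section WedgeDiff.
Variables (R : comNzRingType) (V : lmodType R) (n : nat) (D : 'I_n -> V -> V).
Hypothesis D_linear : forall i, linear (D i).

Let D0 i : D i 0 = 0.
Proof. by have := D_linear i (-1) 0 0; rewrite scaler0 addr0 scaleN1r addNr. Qed.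
Let DD i x y : D i (x + y) = D i x + D i y.
Proof. by have := D_linear i 1 x y; rewrite !scale1r. Qed.
Let DZ i a x : D i (a *: x) = a *: D i x.
Proof. by have := D_linear i a x 0; rewrite D0 !addr0. Qed.
Let Dsum i I (r : seq I) (P : pred I) (G : I -> V) :
  D i (\sum_(k <- r | P k) G k) = \sum_(k <- r | P k) D i (G k).
Proof. by apply: (big_morph (D i)); [apply: DD|apply: D0]. Qed.

Lemma wedge_diff_linear : linear (wedge_diff D).
Proof.
move=> a v w; apply/ffunP => S; rewrite !ffunE scaler_sumr -big_split /=.
apply: eq_bigr => i _; rewrite !ffunE D_linear scalerDr !scalerA.
by congr (_ *: _ + _); rewrite mulrC.
Qed.

(** The terms indexed by (i, j) and (j, i) cancel: for j < i, removing j from S lowers [below S i]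
    by one, while removing i leaves [below S j] unchanged. *)
Lemma wedge_diff_comp0 (D_comm : forall i j v, D i (D j v) = D j (D i v)) w :
  wedge_diff D (wedge_diff D w) = 0.
Proof.
apply/ffunP => S; rewrite ffunE [RHS]ffunE.
pose G i j := (-1) ^+ below S i *:
  ((-1) ^+ below (S :\ i) j *: D i (D j (w (S :\ i :\ j)))).
have GN (i j : 'I_n) : i \in S -> j \in S -> (j < i)%N -> G i j + G j i = 0.
  move=> iS jS ji; rewrite /G (below_D1 _ (ltnW ji)) (belowD1 jS ji) exprS mulN1r.
  rewrite scaleNr !scalerA D_comm !setDDl (setUC [set i]).
  by rewrite [in X in _ + X]mulrC addNr.
(* The double sum is split into j < i and i < j; exchanging the order in the second half lines up
   the cancelling pairs. *)
rewrite (eq_bigr (fun i : 'I_n => \sum_(j in S | (j < i)%N) G i j +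
  \sum_(j in S | (i < j)%N) G i j)); last first.
  move=> i iS; rewrite ffunE Dsum scaler_sumr (bigID (fun j : 'I_n => (j < i)%N)) /=.
  congr (_ + _); apply: eq_big => [j|j _]; rewrite ?DZ //.
    by rewrite !inE; case: eqP => [->|_] //=; rewrite ltnn andbF.
  by rewrite !inE -leqNgt ltn_neqAle -(inj_eq val_inj) [in RHS]eq_sym andbAC andbC.
rewrite big_split /= [X in _ + X](exchange_big_dep (mem S)) /=; last first.
  by move=> i j _ /andP[].
rewrite -big_split big1 //= => i iS.
rewrite [X in _ + X](eq_bigl (fun j => (j \in S) && (j < i)%N)); last first.
  by move=> j; rewrite iS.
by rewrite -big_split big1 //= => j /andP[jS ji]; apply: GN.
Qed.

(** Splittings and primitives are built on inhomogeneous forms; this projection restores the degree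
    afterwards. *)
Definition form_part (k : nat) (w : diff_form V n) : diff_form V n :=
  [ffun S : {set 'I_n} => if #|S| == k then w S else 0].

Lemma wedge_diff_part k w :
  wedge_diff D (form_part k w) = form_part k.+1 (wedge_diff D w).
Proof.
apply/ffunP => S; rewrite !ffunE; case: eqP => Sk.
  apply: eq_bigr => i iS; rewrite ffunE; suff -> : #|S :\ i| == k by [].
  by move: Sk; rewrite (cardsD1 i) iS add1n => -[->].
rewrite big1 // => i iS; rewrite ffunE; case: eqP => [e|_]; last by rewrite D0 scaler0.
by case: Sk; rewrite (cardsD1 i) iS e add1n.
Qed.

Lemma wedge_diff_top v : wedge_diff D (top_form n v) = 0.
Proof.
apply/ffunP => S; rewrite !ffunE big1 // => i iS; rewrite ffunE.
case: eqP => [/setP/(_ i)|_]; last by rewrite D0 scaler0.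
by rewrite !inE eqxx.
Qed.

End WedgeDiff.

Section Koszul.
Variables (R : comNzRingType) (V : comAlgType R) (n : nat) (s : 'I_n -> V).

Let K (w : {set 'I_n} -> V) (S : {set 'I_n}) : V :=
  \sum_(i in S) (-1) ^+ below S i * (s i * w (S :\ i)).

Let I (j : nat) : {set 'I_n} := [set i : 'I_n | (i < j)%N].

Let KD v w S : K (fun S => v S + w S) S = K v S + K w S.
Proof. by rewrite /K -big_split; apply: eq_bigr => i _; rewrite !mulrDr. Qed.

Let KN w S : K (fun S => - w S) S = - K w S.
Proof. by rewrite /K -sumrN; apply: eq_bigr => i _; rewrite !mulrN. Qed.

Let K_ideal w j : in_ideal s j (K w (I j)).
Proof.
exists (fun i => (-1) ^+ below (I j) i * w (I j :\ i)); rewrite /K.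
by apply: eq_big => [i|i _]; rewrite ?inE //; ring.
Qed.

(** The coefficients of [g] are placed, with signs, on the sets I_j minus one point. A proper subset
    of I_j is unaffected, because removing a point from it leaves too few elements. *)
Let ideal_K (j : nat) g : in_ideal s j g ->
  exists e, forall S : {set _}, S \subset I j -> K e S = if S == I j then g else 0.
Proof.
move=> [c gE].
exists (fun T => \sum_(i in I j) if T == I j :\ i then (-1) ^+ below (I j) i * c i else 0).
move=> S SI; case: eqP => [->|/eqP nS]; rewrite /K.
  rewrite gE; apply: eq_big => [i|i iI]; first by rewrite inE.
  rewrite (bigD1 i) //= eqxx big1 ?addr0 => [|k /andP[kI ki]].
    by rewrite [s i * _]mulrCA signrMK mulrC.
  case: eqP => // /setP/(_ i); rewrite !inE eqxx /= eq_sym ki /=.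
  by move: iI; rewrite inE => ->.
rewrite big1 // => i iS; rewrite big1 ?mulr0 // => k kI; case: eqP => // e.
have /proper_card : S \proper I j by rewrite properEneq nS.
by rewrite (cardsD1 i) (cardsD1 k (I j)) iS kI e ltnn.
Qed.

(** The index j exceeds every element of S, so inserting it changes no other sign and its own sign
    is (-1)^|S|. *)
Let K_insert w (j : 'I_n) (S : {set _}) : S \subset I j ->
  K w (j |: S) = K (fun T => w (j |: T)) S + (-1) ^+ #|S| * (s j * w S).
Proof.
move=> SI; have lt i : i \in S -> (i < j)%N by move=> /(subsetP SI); rewrite inE.
have jS : j \notin S by apply/negP => /lt; rewrite ltnn.
rewrite /K big_setU1 //= addrC; congr (_ + _); last first.
  rewrite setU1K //; congr ((-1) ^+ _ * _); apply: eq_card => i.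
  by rewrite !inE; case: eqP => [->|_] /=; rewrite ?ltnn ?(negPf jS) //; apply/andb_idr/lt.
apply: eq_bigr => i iS; congr ((-1) ^+ _ * (_ * w _)).
  by rewrite -(below_D1 _ (ltnW (lt _ iS))) setU1K.
rewrite setDUl; congr (_ :|: _); apply/setDidPl; rewrite disjoints1 inE.
by apply: contraNneq jS => ->.
Qed.

Hypothesis s_reg : regular_sequence s.

(* Induction on [j], splitting a form on dx_0, ..., dx_j according to whether dx_j
   occurs; regularity of [s j] kills the top coefficient left by the part without
   dx_j. *)
Let exact_step (j : nat) : (j <= n)%N -> forall w,
  (forall S : {set _}, S \subset I j -> K w S = 0) ->
  exists e g, forall S : {set _}, S \subset I j -> w S = K e S + if S == I j then g else 0.
Proof.
elim: j => [_|j IH jn] w hw.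
  have I0 : I 0 = set0 by apply/setP => i; rewrite !inE.
  exists (fun=> 0), (w set0) => S; rewrite I0 subset0 => /eqP->.
  by rewrite eqxx /K big_set0 add0r.
pose o := Ordinal jn.
have IS : I j.+1 = o |: I j by apply/setP => i; rewrite !inE ltnS leq_eqVlt.
have oI : o \notin I j by rewrite inE ltnn.
have sub0 (S : {set _}) : S \subset I j -> S \subset I j.+1.
  by move=> h; rewrite IS; apply: subset_trans h _; apply: subsetUr.
have sub1 (S : {set _}) : S \subset I j -> o |: S \subset I j.+1 by move=> h; rewrite IS setUS.
have [e1 [g hg]] := IH (ltnW jn) w (fun S h => hw S (sub0 S h)).
pose w2 (T : {set 'I_n}) := w (o |: T).
have hw2 (S : {set _}) : S \subset I j -> K w2 S = - ((-1) ^+ #|S| * (s o * w S)).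
  move=> SI; apply/eqP; rewrite -addr_eq0; apply/eqP.
  by rewrite -(K_insert w (j := o)) // hw // sub1.
(* At the full set I_j, [hw2] expresses s_j w through a value of [K]. Values of [K] there lie in the
   ideal of the first j elements, hence so does s_j g, and regularity removes s_j. *)
have /ideal_K[e3 he3] : in_ideal s j g.
  apply: (s_reg.1 o); have [c1 h1] := K_ideal w2 j; have [c2 h2] := K_ideal e1 j.
  exists (fun i => - ((-1) ^+ #|I j| * c1 i) - s o * c2 i).
  transitivity (- ((-1) ^+ #|I j| * K w2 (I j)) - s o * K e1 (I j)).
    have := hg _ (subxx (I j)); rewrite eqxx => wE.
    by rewrite hw2 // wE mulrN opprK signrMK; ring.
  rewrite h1 h2 !mulr_sumr -!sumrN -big_split /=.
  by apply: eq_bigr => i _; ring.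
pose e1' (S : {set 'I_n}) := e1 S + e3 S.
have hw1 (S : {set _}) : S \subset I j -> w S = K e1' S.
  by move=> SI; rewrite hg // KD he3.
(* This is the contribution of [e1'] to the part containing dx_j; subtracting it makes [w2] closed
   in the first j variables, so the induction hypothesis applies again. *)
pose u (S : {set 'I_n}) := (-1) ^+ #|S| * (s o * e1' S).
have Ku (S : {set _}) : S \subset I j -> K u S = - ((-1) ^+ #|S| * (s o * w S)).
  move=> SI; rewrite hw1 // /K !mulr_sumr -sumrN; apply: eq_bigr => i iS.
  by rewrite /u [in RHS](cardsD1 i) iS add1n exprS; ring.
have [|e2 [h hh]] := IH (ltnW jn) (fun S => w2 S - u S).
  by move=> S SI; rewrite KD KN Ku // hw2 // subrr.
exists (fun T : {set 'I_n} => if o \in T then e2 (T :\ o) else e1' T), h => S SI.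
have [oS|oS] := boolP (o \in S); last first.
  have SIj : S \subset I j.
    apply/subsetP => i iS; have := subsetP SI i iS; rewrite IS !inE.
    by case/orP => // /eqP iE; rewrite -iE iS in oS.
  rewrite hw1 // (_ : S == _ = false) ?addr0; last first.
    by apply: contraNF oS => /eqP->; rewrite IS !inE eqxx.
  by apply: eq_bigr => i iS; rewrite in_setD (negPf oS) andbF.
have SE : S = o |: (S :\ o) by rewrite setD1K.
have SI' : S :\ o \subset I j.
  apply/subsetP => i; rewrite in_setD1 => /andP[io /(subsetP SI)].
  by rewrite IS in_setU1 (negPf io).
rewrite SE K_insert // -SE setD11 IS.
rewrite (_ : (S == o |: I j) = (S :\ o == I j)); last first.
  apply/eqP/eqP => [->|<-]; first by rewrite setU1K.
  by rewrite setD1K.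
have := hh _ SI'; rewrite /w2 -SE => /eqP; rewrite subr_eq => /eqP ->.
rewrite -/(u _) addrAC; congr (_ + _ + _); apply: eq_bigr => i iS.
rewrite !inE eqxx /=; congr (_ * (_ * e2 _)).
have io : i != o by move: iS; rewrite !inE => /andP[].
apply/setP => k; rewrite !inE; case: eqP => //= _; case: eqP => //=.
Qed.

Lemma koszul_exact (w : diff_form V n) :
  wedge_diff (fun i g => s i * g) w = 0 ->
  exists e g, w = wedge_diff (fun i g => s i * g) e + top_form n g.
Proof.
move=> hw; have KE (v : diff_form V n) S : wedge_diff (fun i g => s i * g) v S = K v S.
  rewrite ffunE; apply: eq_bigr => i _.
  rewrite -[in RHS]signr_odd -signr_odd -/(below S i).
  by case: (odd _); rewrite ?scaleN1r ?mulN1r ?scale1r ?mul1r.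
have In : I n = setT by apply/setP => i; rewrite !inE ltn_ord.
have [|e [g he]] := exact_step (leqnn n) (w := w).
  by move=> S _; rewrite -KE hw ffunE.
exists [ffun S => e S], g; apply/ffunP => S; rewrite ffunE KE ffunE he ?In ?subsetT //.
by congr (_ + _); apply: eq_bigr => i _; rewrite ffunE.
Qed.

End Koszul.

(** * Homotopies over the residue field *)

Section MatrixHomotopy.
Variables (F : fieldType) (N : nat) (D H : 'M[F]_N).
Hypotheses (DD0 : D *m D = 0) (HD0 : H *m D = 0).
Hypothesis kerD : (kermx D <= D + H)%MS.
Hypothesis capDH : (D :&: H = 0)%MS.

(* With [D^+ := pinvmx D], [1 - D D^+] projects onto the kernel [D + H] of [D];
   the homotopy is this projection followed by the one onto [D] and by [D^+]. *)
Lemma matrix_homotopy : exists s P : 'M[F]_N,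
  [/\ (P <= H)%MS, s *m D + D *m s = 1%:M - P, D *m P = 0 & H *m P = H].
Proof.
pose Z := 1%:M - D *m pinvmx D.
have DpD : D *m pinvmx D *m D = D by rewrite mulmxKpV.
have ZD : Z *m D = 0 by rewrite mulmxBl mul1mx DpD subrr.
have Zid (W : 'M_N) : W *m D = 0 -> W *m Z = W.
  by move=> WD; rewrite mulmxBr mulmx1 mulmxA WD mul0mx subr0.
have capHD : (H :&: D = 0)%MS by rewrite capmxC.
have ZDH : (Z <= D + H)%MS by apply: submx_trans kerD; apply/sub_kermxP.
exists (Z *m proj_mx D H *m pinvmx D), (Z *m proj_mx H D); split.
- exact: proj_mx_sub.
(* Here D Z = D because D D = 0. So D s reduces to D D^+ = 1 - Z and s D to Z followed by the
   projection onto D; what is missing from 1 is Z followed by the projection onto H. *)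
- rewrite mulmxKpV ?proj_mx_sub // (mulmxA D (Z *m _)) (mulmxA D Z) Zid // proj_mx_id //.
  rewrite -[D *m pinvmx D](subKr 1%:M) -/Z addrCA; congr (_ + _).
  by apply/eqP; rewrite -subr_eq0 opprK addrAC add_proj_mx ?subrr.
- by rewrite mulmxA Zid // proj_mx_0.
- by rewrite mulmxA Zid // proj_mx_id.
Qed.

End MatrixHomotopy.

Section FiniteHomotopy.
Variables (F : fieldType) (T : finType) (A : pred T) (K : T -> T -> F).
Let D (v : T -> F) (x : T) : F := \sum_y v y * K y x.
Let supported (c : T -> F) : Prop := forall x, ~~ A x -> c x = 0.

Hypothesis DD0 : forall v x, D (D v) x = 0.
Hypothesis DA0 : forall c, supported c -> forall x, D c x = 0.
Hypothesis kerD : forall v, (forall x, D v x = 0) ->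
  exists e c, supported c /\ forall x, v x = D e x + c x.
Hypothesis indep : forall c e, supported c -> (forall x, c x = D e x) ->
  forall x, c x = 0.

(** This is [matrix_homotopy] with H the diagonal projector onto functions supported on [A]. Then
    [kerD] and [indep] say that the image of D and the supported functions are complementary in the
    kernel. *)
Lemma finite_homotopy : exists s P : T -> T -> F,
  [/\ forall y x, ~~ A x -> P y x = 0,
      forall z x, \sum_y s z y * K y x + \sum_y K z y * s y x =
        (z == x)%:R - P z x,
      forall z x, \sum_y K z y * P y x = 0
    & forall y x, A y -> P y x = (y == x)%:R].
Proof.
pose N := #|T|.
pose vec (v : T -> F) : 'rV[F]_N := \row_j v (enum_val j).
pose fct (u : 'rV[F]_N) x := u 0 (enum_rank x).
have fctK u : vec (fct u) = u by apply/rowP => j; rewrite mxE /fct enum_valK.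
pose MK : 'M[F]_N := \matrix_(i, j) K (enum_val i) (enum_val j).
pose MH : 'M[F]_N := \matrix_(i, j) ((i == j) && A (enum_val i))%:R.
have sumE (f : T -> F) : \sum_y f y = \sum_(j < N) f (enum_val j).
  by rewrite (reindex (@enum_val T T)) //; apply: onW_bij; apply: enum_val_bij.
have fctD u x : fct (u *m MK) x = D (fct u) x.
  rewrite /fct mxE /D sumE; apply: eq_bigr => j _.
  by rewrite mxE enum_rankK /fct enum_valK.
have fctH u x : fct (u *m MH) x = if A x then fct u x else 0.
  rewrite /fct mxE (bigD1 (enum_rank x)) //= mxE eqxx enum_rankK big1 ?addr0.
    by case: (A x); rewrite ?mulr1 ?mulr0.
  by move=> j /negPf jx; rewrite mxE jx mulr0.
have fct_inj u v : (forall x, fct u x = fct v x) -> u = v.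
  by move=> uv; rewrite -(fctK u) -(fctK v); apply/rowP => j; rewrite !mxE uv.
have fct0 x : fct 0 x = 0 by rewrite /fct mxE.
have fctB u v x : fct (u + v) x = fct u x + fct v x by rewrite /fct mxE.
have suppH u : supported (fct (u *m MH)) by move=> x /negPf Ax; rewrite fctH Ax.
have subH (u : 'rV_N) : supported (fct u) -> (u <= MH)%MS.
  move=> hu; suff <- : u *m MH = u by apply: submxMl.
  by apply: fct_inj => x; rewrite fctH; case: ifPn => // /hu.
have [] := @matrix_homotopy F N MK MH.
- apply/row_matrixP => i; rewrite row_mul row0; apply: fct_inj => x.
  rewrite fctD fct0 -[RHS](DD0 (fct (delta_mx 0 i)) x) rowE; congr D.
  by apply/funext => y; rewrite fctD.
- apply/row_matrixP => i; rewrite row_mul row0; apply: fct_inj => x.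
  by rewrite fctD fct0 rowE DA0.
- apply/rV_subP => u /sub_kermxP uD.
  have [|e [c [hc he]]] := kerD (v := fct u); first by move=> x; rewrite -fctD uD fct0.
  suff -> : u = vec e *m MK + vec c.
    apply: addmx_sub_adds; first exact: submxMl.
    by apply: subH => x /hc; rewrite /fct mxE enum_rankK.
  apply: fct_inj => x; rewrite fctB fctD he /fct mxE enum_rankK; congr (_ + _).
  by congr D; apply/funext => y; rewrite mxE enum_rankK.
- apply/eqP/rowV0P => u; rewrite sub_capmx => /andP[/submxP[e ->] /submxP[c h]].
  apply: fct_inj => x; rewrite fct0 h.
  by apply: (indep (suppH c) (e := fct e)) => y; rewrite -h fctD.
move=> s [P [/submxP[Q PE] sD DP HP]].
exists (fun y x => s (enum_rank y) (enum_rank x)), (fun y x => P (enum_rank y) (enum_rank x)).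
have er (x y : T) : (enum_rank x == enum_rank y) = (x == y).
  by apply: inj_eq; apply: enum_rank_inj.
split=> [y x Ax|z x|z x|y x Ay].
- rewrite PE mxE big1 // => j _; rewrite mxE; case: eqP => [->|_]; rewrite ?mulr0 //.
  by rewrite enum_rankK (negPf Ax) mulr0.
- have /matrixP/(_ (enum_rank z) (enum_rank x)) := sD.
  rewrite !mxE er => <-; rewrite !sumE; congr (_ + _); apply: eq_bigr => j _;
  by rewrite mxE enum_valK enum_rankK.
- have /matrixP/(_ (enum_rank z) (enum_rank x)) := DP.
  rewrite !mxE => DPzx; rewrite sumE -[RHS]DPzx; apply: eq_bigr => j _.
  by rewrite mxE enum_valK enum_rankK.
- have /matrixP/(_ (enum_rank y) (enum_rank x)) := HP.
  rewrite !mxE er enum_rankK Ay andbT (bigD1 (enum_rank y)) //= mxE eqxx enum_rankK Ay mul1r.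
  by rewrite big1 ?addr0 // => j jy; rewrite mxE eq_sym (negPf jy) mul0r.
Qed.

End FiniteHomotopy.

Section Kernels.
Variables (n e : nat).

(* [(u, S)] stands for x^u dx_S. *)
Definition form_index : Type := ('X_{1..n} * {set 'I_n})%type.
HB.instance Definition _ := Choice.on form_index.
Implicit Types (x y z : form_index) (S : {set 'I_n}).

(* The grading preserved by the wedge product with a 1-form whose coefficients
   are homogeneous of degree [e]. *)
Definition weight x : nat := (mdeg x.1 + e * #|~: x.2|)%N.

(** The degree is at most the weight, so each fibre is finite and a sum over it raises no question
    of convergence. *)
Definition weight_fibre (m : nat) : seq form_index :=
  [seq x <- [seq ((val u, T) : form_index) |
              u <- enum {: 'X_{1..n < m.+1}}, T <- enum {: {set 'I_n}}] | weight x == m].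

Lemma mem_weight_fibre m x : (x \in weight_fibre m) = (weight x == m).
Proof.
rewrite mem_filter andb_idr // => /eqP wx; apply/allpairsP.
have um : (mdeg x.1 < m.+1)%N by rewrite ltnS -wx leq_addr.
by exists (BMultinom um, x.2); rewrite !mem_enum /=; split=> //; case: (x).
Qed.

Lemma weight_fibre_uniq m : uniq (weight_fibre m).
Proof.
apply: filter_uniq; apply: allpairs_uniq; rewrite ?enum_uniq //.
by move=> [u S] [v T] _ _ /= [/val_inj-> ->].
Qed.

(** Wedging with dx_i lowers the weight by e, which compensates multiplication by a coefficient of
    degree e. *)
Lemma weight_insert u S i : i \in S ->
  weight (u, S :\ i) = (weight (u, S) + e)%N.
Proof.
move=> iS; rewrite /weight /= -addnA -mulnSr; congr (_ + e * _)%N.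
by rewrite setCD setUC cardsU1 inE iS.
Qed.

Section Ring.
Variable A : comNzRingType.

(** A block-diagonal operator, one block for each weight. Kernels act on the right, as matrices do
    on row vectors. *)
Definition kernel_op (K : form_index -> form_index -> A) (w : form_index -> A) x : A :=
  \sum_(y <- weight_fibre (weight x)) w y * K y x.

(** The common formula for products of polynomials and of power series, over any ring, so that
    [koszul] makes sense both over F_q and over L. *)
Definition conv (g h : 'X_{1..n} -> A) (u : 'X_{1..n}) : A :=
  \sum_(k : 'X_{1..n < (mdeg u).+1, (mdeg u).+1} | u == (k.1 + k.2)%MM)
    g k.1 * h k.2.

Variable g : 'I_n -> 'X_{1..n} -> A.

Definition koszul (w : form_index -> A) x : A :=
  \sum_(i in x.2) (-1) ^+ below x.2 i * conv (g i) (fun v => w (v, x.2 :\ i)) x.1.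

Definition koszul_kernel y x : A := koszul (fun z => (z == y)%:R) x.

Lemma koszulE w x : (forall i k, mdeg k != e -> g i k = 0) ->
  koszul w x = kernel_op koszul_kernel w x.
Proof.
move=> ge; rewrite /kernel_op.
under eq_bigr do rewrite mulr_sumr.
rewrite exchange_big /=; apply: eq_bigr => i iS.
under eq_bigr do rewrite mulrCA.
rewrite -mulr_sumr; congr (_ * _).
under eq_bigr do rewrite mulr_sumr.
rewrite exchange_big /=; apply: eq_bigr => k /eqP xk.
have [kd|kd] := eqVneq (mdeg k.1) e; last first.
  by rewrite ge // mul0r big1 // => y _; rewrite mul0r mulr0.
pose z : form_index := (val k.2, x.2 :\ i).
rewrite (bigD1_seq z) ?weight_fibre_uniq //=; last first.
  rewrite mem_weight_fibre weight_insert //; apply/eqP.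
  by have := congr1 (@mdeg n) xk; rewrite mdegD kd /weight /=; lia.
rewrite eqxx mulr1 mulrC big1 ?addr0 // => y yz.
by rewrite eq_sym (negPf yz) !mulr0.
Qed.

End Ring.
End Kernels.

Lemma coboundary_gt0 (R : comNzRingType) (V : lmodType R) n (C : V -> Prop)
    (delta : diff_form V n -> diff_form V n) k w : (0 < k)%N ->
  coboundary C delta k w <-> exists2 e, is_form C k.-1 e & w = delta e.
Proof. by case: k. Qed.

Section PolynomialForms.
Variables (F : fieldType) (n e : nat) (G : 'I_n -> {mpoly F[n]}).
Hypothesis G_homog : forall i k, mdeg k != e -> (G i)@_k = 0.
Let delta := wedge_diff (fun i g => G i * g).
Implicit Types (w : diff_form {mpoly F[n]} n) (x : form_index n).

Let Gcoef (i : 'I_n) k := (G i)@_k.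
Let flat w x : F := (w x.2)@_x.1.

Let G_linear i : linear (fun g => G i * g).
Proof. by move=> a u v; rewrite mulrDr scalerAr. Qed.

Let flat_inj w w' : (forall x, flat w x = flat w' x) -> w = w'.
Proof. by move=> h; apply/ffunP => S; apply/mpolyP => u; apply: (h (u, S)). Qed.

Let flatD w w' x : flat (w + w') x = flat w x + flat w' x.
Proof. by rewrite /flat ffunE mcoeffD. Qed.

Let flat_delta w x : flat (delta w) x = koszul Gcoef (flat w) x.
Proof.
rewrite /flat ffunE raddf_sum; apply: eq_bigr => i _.
by rewrite /= mcoeffZ mcoeffM.
Qed.

Let flat_top h x : flat (top_form n h) x = if x.2 == setT then h@_x.1 else 0.
Proof. by rewrite /flat ffunE; case: eqP; rewrite ?mcoeff0. Qed.

Variables (N : nat) (mu : 'I_N -> 'X_{1..n}).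

Definition basis_index (x : form_index n) : bool :=
  (x.2 == setT) && (x.1 \in codom mu).

Hypothesis n_gt0 : (0 < n)%N.
Hypothesis G_reg : regular_sequence G.
Hypothesis mu_basis : cohomology_basis (fun _ : {mpoly F[n]} => True)
  delta n (fun i => top_form n 'X_[mu i]).

(** An inhomogeneous primitive is allowed: its part of degree n-1 already has the given top form as
    image. *)
Let indep c w : \sum_(i < N) c i *: top_form n 'X_[mu i] = delta w ->
  forall i, c i = 0.
Proof.
move=> h; case: mu_basis => _ hc _; apply: hc; apply/(coboundary_gt0 _ _ _ n_gt0).
exists (form_part n.-1 w) => [S|]; first by rewrite ffunE; case: eqP.
rewrite /delta wedge_diff_part // prednK // -/delta -h.
apply/ffunP => S; rewrite [RHS]ffunE; case: eqP => // Sn.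
rewrite sum_ffunE big1 // => i _; rewrite !ffunE; case: eqP => [SE|_]; last by rewrite scaler0.
by case: Sn; rewrite SE cardsT card_ord.
Qed.

Lemma basis_monomials_inj : injective mu.
Proof.
move=> i j ij; apply/eqP/negPn/negP => nij.
suff /indep/(_ i)/eqP :
    \sum_(k < N) ((k == i)%:R - (k == j)%:R : F) *: top_form n 'X_[mu k] = delta 0.
  by rewrite eqxx (negPf nij) subr0 oner_eq0.
have -> : delta 0 = 0.
  by apply/ffunP => S; rewrite !ffunE big1 // => k _; rewrite ffunE mulr0 scaler0.
under eq_bigr do rewrite scalerBl.
rewrite sumrB (bigD1 i) //= eqxx scale1r big1 => [|k /negPf->]; last by rewrite scale0r.
rewrite (bigD1 j) //= eqxx scale1r big1 => [|k /negPf->]; last by rewrite scale0r.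
by rewrite ij subrr.
Qed.

(** [finite_homotopy] is applied to the fibre. Its kernel hypothesis combines Koszul exactness,
    which leaves a top form, with the spanning part of [mu_basis]; its independence hypothesis is
    the other part. Vectors on the fibre become polynomial forms by extension by zero. *)
Lemma polynomial_homotopy_fibre (m : nat) (r := weight_fibre n e m) :
  exists s P : form_index n -> form_index n -> F,
  [/\ forall y x, y \in r -> x \in r -> ~~ basis_index x -> P y x = 0,
      forall z x, z \in r -> x \in r ->
        \sum_(y <- r) s z y * koszul_kernel Gcoef y x
          + \sum_(y <- r) koszul_kernel Gcoef z y * s y x = (z == x)%:R - P z x,
      forall z x, z \in r -> x \in r ->
        \sum_(y <- r) koszul_kernel Gcoef z y * P y x = 0
    & forall y x, y \in r -> x \in r -> basis_index y -> P y x = (y == x)%:R].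
Proof.
pose elt (i : 'I_(size r)) := tnth (in_tuple r) i.
have elt_inj : injective elt.
  by move=> i j; apply/tuple_uniqP; apply: weight_fibre_uniq.
have elt_mem i : elt i \in r by apply: mem_tnth.
have eltP x : x \in r -> exists i, x = elt i by move=> /seq_tnthP[i ->]; exists i.
have sumr (f : form_index n -> F) : \sum_(y <- r) f y = \sum_i f (elt i).
  by rewrite big_tnth.
have elt_wt i : weight e (elt i) = m by apply/eqP; rewrite -mem_weight_fibre.
pose K i j := koszul_kernel Gcoef (elt i) (elt j).
pose ext (v : 'I_(size r) -> F) x := \sum_i v i * (elt i == x)%:R.
have ext_elt v i : ext v (elt i) = v i.
  rewrite /ext (bigD1 i) //= eqxx mulr1 big1 ?addr0 // => j ji.
  by rewrite (inj_eq elt_inj) (negPf ji) mulr0.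
have ext0 v x : weight e x != m -> ext v x = 0.
  move=> xm; rewrite /ext big1 // => j _; case: eqP => [xE|_]; last by rewrite mulr0.
  by rewrite -xE elt_wt eqxx in xm.
pose form (v : 'I_(size r) -> F) : diff_form {mpoly F[n]} n :=
  [ffun S => \sum_(u : 'X_{1..n < m.+1}) ext v (val u, S) *: 'X_[val u]].
have flat_form v x : flat (form v) x = ext v x.
  rewrite /flat ffunE; have [um|um] := ltnP (mdeg x.1) m.+1.
    by rewrite (mcoeff_mpoly (fun u => ext v (u, x.2))) //; case: (x).
  rewrite raddf_sum big1 /= => [|u _].
    by rewrite ext0 // /weight; apply: contraTneq um => <-; rewrite -ltnNge ltnS leq_addr.
  rewrite mcoeffZ mcoeffX; case: eqP => [uE|_]; last by rewrite mulr0.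
  by have := bmdeg u; rewrite uE ltnNge um.
have D_koszul (w : form_index n -> F) i : \sum_j w (elt j) * K j i = koszul Gcoef w (elt i).
  by rewrite (koszulE _ _ G_homog) /kernel_op elt_wt sumr.
have D_form v i : \sum_j v j * K j i = flat (delta (form v)) (elt i).
  rewrite flat_delta -D_koszul; apply: eq_bigr => j _.
  by rewrite flat_form ext_elt.
have flat_delta0 v x : weight e x != m -> flat (delta (form v)) x = 0.
  move=> xm; rewrite flat_delta (koszulE _ _ G_homog) /kernel_op big_seq big1 // => y.
  by rewrite mem_weight_fibre => /eqP ym; rewrite flat_form ext0 ?mul0r // ym.
have form_inj w v : (forall x, weight e x != m -> flat w x = 0) ->
    (forall i, flat w (elt i) = v i) -> w = form v.
  move=> w0 wv; apply: flat_inj => x; rewrite flat_form.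
  have [xm|xm] := eqVneq (weight e x) m; last by rewrite w0 ?ext0.
  have [|i ->] := eltP x; first by rewrite mem_weight_fibre xm.
  by rewrite ext_elt.
have supp_top c : (forall i, ~~ basis_index (elt i) -> c i = 0) ->
    form c = \sum_(k < N) ext c (mu k, setT) *: top_form n 'X_[mu k].
  move=> hc; apply: flat_inj => x; rewrite flat_form /flat sum_ffunE raddf_sum /=.
  under eq_bigr do rewrite ffunE mcoeffZ -/(flat _ x) flat_top mcoeffX.
  have [xm|xm] := eqVneq (weight e x) m; last first.
    rewrite ext0 // big1 // => k _; case: eqP => [xT|_]; last by rewrite mulr0.
    case: eqP => [ux|_]; last by rewrite mulr0.
    by rewrite ext0 ?mul0r // (_ : (mu k, setT) = x) // ux -xT; case: (x).
  have [|i xE] := eltP x; first by rewrite mem_weight_fibre xm.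
  have [bi|bi] := boolP (basis_index x); last first.
    rewrite xE ext_elt hc -?xE // big1 // => k _; case: eqP => [xT|_]; last by rewrite mulr0.
    case: eqP => [ux|_]; last by rewrite mulr0.
    by case/negP: bi; rewrite /basis_index xT eqxx -ux codom_f.
  case/andP: bi => /eqP xT /codomP[k xk].
  rewrite xT eqxx (bigD1 k) //= xk eqxx mulr1 big1 ?addr0 => [|l lk].
    by rewrite -xk -xT; case: (x).
  by rewrite (inj_eq basis_monomials_inj) (negPf lk) mulr0.
have [] := @finite_homotopy F 'I_(size r) (fun i => basis_index (elt i)) K.
- move=> v i; under eq_bigr do rewrite D_form.
  rewrite D_koszul -flat_delta /delta wedge_diff_comp0 //.
    by rewrite /flat ffunE mcoeff0.
  by move=> *; rewrite mulrCA.
- move=> c hc i; rewrite D_form supp_top //; set t := \sum_(k < N) _.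
  suff -> : t = top_form n (t setT).
    by rewrite /delta wedge_diff_top // /flat ffunE mcoeff0.
  apply/ffunP => S; rewrite ffunE; case: eqP => [->//|/eqP ST].
  by rewrite sum_ffunE big1 // => k _; rewrite !ffunE (negPf ST) scaler0.
- move=> v hv.
  have /koszul_exact : wedge_diff (fun i g => G i * g) (form v) = 0.
    apply: flat_inj => x; rewrite -/delta [RHS]/flat ffunE mcoeff0.
    have [xm|xm] := eqVneq (weight e x) m; last exact: flat_delta0.
    have [|i ->] := eltP x; first by rewrite mem_weight_fibre xm.
    by rewrite -D_form.
  case=> // w1 [h hh]; case: mu_basis => _ _ /(_ (top_form n h)) [].
    split; last exact: wedge_diff_top.
    move=> S; rewrite ffunE; case: eqP => // Sn; case: eqP => // ST.
    by case: Sn; rewrite ST cardsT card_ord.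
  move=> c /(coboundary_gt0 _ _ _ n_gt0)[w2 _ /eqP]; rewrite subr_eq => /eqP hc.
  (* The primitive [w1 + w2] may have components of other weights; restricting it to the fibre is
     harmless, since by [D_koszul] only the fibre enters. *)
  exists (fun i => flat (w1 + w2) (elt i)),
    (fun i => flat (\sum_(k < N) c k *: top_form n 'X_[mu k]) (elt i)).
  split=> i.
    rewrite /flat sum_ffunE raddf_sum /= => bi; rewrite big1 // => k _.
    rewrite ffunE mcoeffZ -/(flat _ (elt i)) flat_top; case: eqP => [iT|_]; last by rewrite mulr0.
    rewrite mcoeffX; case: eqP => [iu|_]; last by rewrite mulr0.
    by case/negP: bi; rewrite /basis_index iT eqxx -iu codom_f.
  rewrite D_koszul -flat_delta -flatD -[v i]ext_elt -flat_form hh; congr flat.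
  have dD : delta (w1 + w2) = delta w1 + delta w2.
    by have := wedge_diff_linear G_linear 1 w1 w2; rewrite !scale1r.
  by rewrite dD -addrA -hc.
- move=> c v hc cv i.
  have cE : form c = delta (form v).
    apply/esym/form_inj => [x|j]; first exact: flat_delta0.
    by rewrite -D_form cv.
  have c0 := indep (etrans (esym (supp_top c hc)) cE).
  have [|/hc//] := boolP (basis_index (elt i)); case/andP => /eqP iT /codomP[k ik].
  by rewrite -[LHS]ext_elt -[RHS](c0 k) -ik -iT; case: (elt i).
move=> s [P [P0 sK KP Pid]].
(* A partial inverse of [elt], so that matrices indexed by ordinals become kernels, with value 0 off
   the fibre. *)
pose idx x := [pick i | elt i == x].
have idxK i : idx (elt i) = Some i.
  by rewrite /idx; case: pickP => [j /eqP/elt_inj->//|/(_ i)]; rewrite eqxx.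
pose lift (M : 'I_(size r) -> 'I_(size r) -> F) y x :=
  if (idx y, idx x) is (Some i, Some j) then M i j else 0.
have liftE M i j : lift M (elt i) (elt j) = M i j by rewrite /lift !idxK.
exists (lift s), (lift P); split.
- by move=> _ _ /eltP[i ->] /eltP[j ->]; rewrite liftE; apply: P0.
- move=> _ _ /eltP[i ->] /eltP[j ->]; rewrite liftE (inj_eq elt_inj) -sK !sumr.
  by congr (_ + _); apply: eq_bigr => k _; rewrite liftE.
- move=> _ _ /eltP[i ->] /eltP[j ->]; rewrite sumr -[RHS](KP i j).
  by apply: eq_bigr => k _; rewrite liftE.
- by move=> _ _ /eltP[i ->] /eltP[j ->]; rewrite liftE (inj_eq elt_inj); apply: Pid.
Qed.

Lemma polynomial_homotopy : exists s P : form_index n -> form_index n -> F,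
  let K := koszul_kernel (fun i k => (G i)@_k) in
  [/\ forall y x, weight e y = weight e x -> ~~ basis_index x -> P y x = 0,
      forall z x, weight e z = weight e x ->
        \sum_(y <- weight_fibre n e (weight e x)) s z y * K y x
          + \sum_(y <- weight_fibre n e (weight e x)) K z y * s y x = (z == x)%:R - P z x,
      forall z x, weight e z = weight e x ->
        \sum_(y <- weight_fibre n e (weight e x)) K z y * P y x = 0
    & forall y x, weight e y = weight e x -> basis_index y -> P y x = (y == x)%:R].
Proof.
have /choice[s /choice[P h]] := polynomial_homotopy_fibre.
exists (fun y => s (weight e y) y), (fun y => P (weight e y) y) => K.
split=> z x zx; have [h1 h2 h3 h4] := h (weight e x); rewrite ?zx.
- by apply: h1; rewrite mem_weight_fibre ?zx.
- rewrite -h2 ?mem_weight_fibre ?zx //; congr (_ + _).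
  by rewrite big_seq [RHS]big_seq; apply: eq_bigr => y; rewrite mem_weight_fibre => /eqP->.
- rewrite -[RHS](h3 z x) ?mem_weight_fibre ?zx //.
  by rewrite big_seq [RHS]big_seq; apply: eq_bigr => y; rewrite mem_weight_fibre => /eqP->.
- by apply: h4; rewrite mem_weight_fibre ?zx.
Qed.

End PolynomialForms.

(** * Perturbation of a homotopy *)

Section WeightedNorm.
Variables (p : nat) (L : fieldType) (ord : L -> rat).
Hypothesis hord : padic_valuation p ord.
Variables (X : choiceType) (wt : X -> nat) (fibre : nat -> seq X).
Hypothesis mem_fibre : forall m x, (x \in fibre m) = (wt x == m).
Variable beta : rat.
Implicit Types (r : rat) (v w : X -> L) (x y : X).

(** A ball, in additive notation, for the norm inf_x (ord(w_x) - beta wt(x)). In [norm_null] the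
    quantity ord(w_x) - beta wt(x) tends to infinity, which for the degree and beta = b/d is
    membership in C(b). *)
Definition norm_ge r w : Prop := forall x, ord_ge ord (r + beta * (wt x)%:R) (w x).

Definition norm_null w : Prop := forall r, exists k, forall x,
  (k <= wt x)%N -> ord_ge ord (r + beta * (wt x)%:R) (w x).

Lemma norm_geW r r' w : r' <= r -> norm_ge r w -> norm_ge r' w.
Proof. by move=> rr h x; apply: ord_geW (h x); rewrite lerD2r. Qed.

Lemma norm_geD r v w : norm_ge r v -> norm_ge r w -> norm_ge r (v + w).
Proof. by move=> hv hw x; apply: (ord_geD hord). Qed.

Lemma norm_geN r v : norm_ge r v -> norm_ge r (- v).
Proof. by move=> hv x; apply: (ord_geN hord). Qed.

Lemma norm_geB r v w : norm_ge r v -> norm_ge r w -> norm_ge r (v - w).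
Proof. by move=> hv hw; apply: norm_geD => //; apply: norm_geN. Qed.

Lemma norm_ge_sum r I (s : seq I) (P : pred I) (G : I -> X -> L) :
  (forall i, P i -> norm_ge r (G i)) -> norm_ge r (\sum_(i <- s | P i) G i).
Proof.
by move=> h; apply: big_ind => // u v; exact: norm_geD.
Qed.

Lemma norm_ge_eq0 r eta w : 0 < eta ->
  (forall j : nat, norm_ge (r + j%:R * eta) w) -> w = 0.
Proof.
move=> eta0 h; apply/funext => x.
apply: (ord_ge_arch (r := r + beta * (wt x)%:R) eta0) => j.
by rewrite addrAC; apply: h.
Qed.

Lemma norm_null0 : norm_null 0.
Proof. by move=> r; exists 0%N => x _; apply: ord_ge0. Qed.

Lemma norm_nullD v w : norm_null v -> norm_null w -> norm_null (v + w).
Proof.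
move=> hv hw r; have [k hk] := hv r; have [k' hk'] := hw r.
exists (k + k')%N => x kx; apply: (ord_geD hord); [apply: hk|apply: hk']; lia.
Qed.

Lemma norm_nullN v : norm_null v -> norm_null (- v).
Proof. by move=> hv r; have [k hk] := hv r; exists k => x /hk; apply: (ord_geN hord). Qed.

Lemma norm_null_sum I (s : seq I) (P : pred I) (G : I -> X -> L) :
  (forall i, P i -> norm_null (G i)) -> norm_null (\sum_(i <- s | P i) G i).
Proof. by move=> h; apply: big_ind => // [|u v]; [exact: norm_null0|exact: norm_nullD]. Qed.

(** Only the finitely many indices of small weight escape the bound at infinity. *)
Lemma norm_null_bounded w : norm_null w -> exists r, norm_ge r w.
Proof.
move=> /(_ 0)[k hk].
have [r hr] : exists r, forall x, x \in flatten [seq fibre m | m <- iota 0 k] ->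
    ord_ge ord (r + beta * (wt x)%:R) (w x).
  elim: (flatten _) => [|y s [r hr]]; first by exists 0.
  exists (Num.min r (ord (w y) - beta * (wt y)%:R)) => x.
  rewrite inE => /orP[/eqP->|/hr].
    by right; rewrite -lerBrDr ge_min lexx orbT.
  by apply: ord_geW; rewrite lerD2r ge_min lexx.
exists (Num.min r 0) => x; have [kx|xk] := leqP k (wt x).
  by apply: ord_geW (hk x kx); rewrite lerD2r ge_min lexx orbT.
apply: ord_geW (hr x _); first by rewrite lerD2r ge_min lexx.
apply/flattenP; exists (fibre (wt x)); last by rewrite mem_fibre.
by apply/mapP; exists (wt x); rewrite // mem_iota.
Qed.

Section Series.
Hypothesis L_complete : ord_complete ord.
Variables (r eta : rat) (u : nat -> X -> L).
Hypothesis eta_gt0 : 0 < eta.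
Hypothesis u_small : forall j, norm_ge (r + j%:R * eta) (u j).

Let archi t : exists j : nat, t <= r + j%:R * eta.
Proof.
exists (Num.bound (`|(t - r) / eta|)); rewrite -lerBlDl -ler_pdivrMr //.
apply: le_trans (ler_norm _) _; exact/ltW/archi_boundP.
Qed.

Let tail i j : (i <= j)%N -> norm_ge (r + i%:R * eta) (\sum_(k < j) u k - \sum_(k < i) u k).
Proof.
move=> ij; rewrite -!(big_mkord xpredT) (big_cat_nat (leq0n i) ij) /= addrAC subrr add0r.
rewrite big_nat; apply: norm_ge_sum => k /andP[ik _].
by apply: norm_geW (u_small k); rewrite lerD2l ler_wpM2r ?ler_nat // ltW.
Qed.

(** Completeness gives the limit coordinate by coordinate; the estimate [tail] is uniform in the
    coordinate and passes to the limit. *)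
Lemma norm_series : exists U, forall j, norm_ge (r + j%:R * eta) (U - \sum_(k < j) u k).
Proof.
have /choice[U hU] x : exists l, ord_cvg ord (fun j => (\sum_(k < j) u k) x) l.
  apply: L_complete => t; have [J hJ] := archi (t - beta * (wt x)%:R).
  have hi i : (J <= i)%N -> ord_ge ord t ((\sum_(k < i) u k - \sum_(k < J) u k) x).
    by move=> /tail/(_ x); apply: ord_geW; rewrite -lerBlDr.
  exists J => i j Ji Jj; move: (hi i Ji) (hi j Jj).
  rewrite -![(_ - _) x]/(_ x - _ x) => h1 h2.
  by have := ord_geB hord h1 h2; rewrite opprB addrA subrK.
exists U => j x; have [J hJ] := hU x (r + j%:R * eta + beta * (wt x)%:R).
have := hJ (J + j)%N (leq_addr _ _); have /(_ x) := tail (leq_addl J j).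
rewrite -![(_ - _) x]/(_ x - _ x) => h1 h2.
by have := ord_geB hord h1 h2; congr (ord_ge _ _ _); rewrite opprB addrC addrA subrK.
Qed.

Lemma norm_series_null U : (forall j, norm_null (u j)) ->
  (forall j, norm_ge (r + j%:R * eta) (U - \sum_(k < j) u k)) -> norm_null U.
Proof.
move=> hu hU t; have [J hJ] := archi t.
have hs : norm_null (\sum_(k < J) u k) by apply: norm_null_sum.
have [k hk] := hs t; exists k => x /hk h.
rewrite -[U x](subrK ((\sum_(k < J) u k) x)); apply: (ord_geD hord) => //.
by apply: ord_geW (hU J x); rewrite lerD2r.
Qed.

End Series.
End WeightedNorm.

Section Perturbation.
Variables (p : nat) (L : fieldType) (ord : L -> rat).
Hypothesis hord : padic_valuation p ord.
Hypothesis L_complete : ord_complete ord.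
Variables (X : choiceType) (wt : X -> nat) (fibre : nat -> seq X).
Hypothesis mem_fibre : forall m x, (x \in fibre m) = (wt x == m).
Variables (beta eta : rat) (A : pred X).
Hypothesis eta_gt0 : 0 < eta.
Let norm_ge := norm_ge ord wt beta.
Let norm_null := norm_null ord wt beta.
Let supported (w : X -> L) := forall x, ~~ A x -> w x = 0.

Variables d s P : (X -> L) -> X -> L.
Hypotheses (dB : forall v w, d (v - w) = d v - d w)
  (sB : forall v w, s (v - w) = s v - s w).
Hypotheses (d_norm : forall r w, norm_ge r w -> norm_ge r (d w))
  (s_norm : forall r w, norm_ge r w -> norm_ge r (s w))
  (P_norm : forall r w, norm_ge r w -> norm_ge r (P w)).
Hypotheses (d_null : forall w, norm_null w -> norm_null (d w))
  (s_null : forall w, norm_null w -> norm_null (s w))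
  (P_null : forall w, norm_null w -> norm_null (P w)).
Hypotheses (dd0 : forall w, d (d w) = 0)
  (P_supp : forall w, supported (P w))
  (d_supp : forall w, supported w -> d w = 0).
Hypothesis homotopy : forall r w, norm_ge r w ->
  norm_ge (r + eta) (d (s w) + s (d w) - (w - P w)).
Hypothesis Pd_small : forall r w, norm_ge r w -> norm_ge (r + eta) (P (d w)).
Hypothesis P_id : forall r w, supported w -> norm_ge r w ->
  norm_ge (r + eta) (P w - w).

Let d0 : d 0 = 0. Proof. by have := dB 0 0; rewrite !subr0 subrr. Qed.
Let s0 : s 0 = 0. Proof. by have := sB 0 0; rewrite !subr0 subrr. Qed.
Let dN w : d (- w) = - d w. Proof. by have := dB 0 w; rewrite d0 !sub0r. Qed.
Let dD v w : d (v + w) = d v + d w.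
Proof. by rewrite -[in LHS](opprK w) dB dN opprK. Qed.

(** W is replaced repeatedly by W - d s W - P W. This stays a cocycle, because d d = 0 and d P = 0
    hold exactly, and on cocycles [homotopy] says that it gains [eta]. The sums of the s W_j and of
    the P W_j therefore converge to [e] and [v]. *)
Lemma perturbation_exact w : norm_null w -> d w = 0 ->
  exists e v, [/\ norm_null e, supported v & w = d e + v].
Proof.
move=> wC dw; have [r wr] := norm_null_bounded mem_fibre wC.
pose W j := iter j (fun v => v - d (s v) - P v) w.
have dW j : d (W j) = 0.
  by elim: j => //= j IH; rewrite !dB IH dd0 (d_supp (P_supp _)) !subr0.
have WC j : norm_null (W j).
  elim: j => //= j IH; apply: (norm_nullD hord); last exact/(norm_nullN hord)/P_null.
  by apply: (norm_nullD hord) => //; apply/(norm_nullN hord)/d_null/s_null.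
have Wr j : norm_ge (r + j%:R * eta) (W j).
  elim: j => [|j IH]; first by rewrite mul0r addr0.
  have /= := homotopy IH; rewrite dW s0 addr0 => /(norm_geN hord).
  rewrite -natr1 mulrDl mul1r addrA; congr (norm_ge _ _).
  by rewrite opprB addrAC.
have [e he] := norm_series hord L_complete eta_gt0 (fun j => s_norm (Wr j)).
have [v hv] := norm_series hord L_complete eta_gt0 (fun j => P_norm (Wr j)).
exists e, v; split.
- by apply: (norm_series_null hord eta_gt0 _ he) => j; exact: (s_null (WC j)).
- move=> x Ax; apply: (ord_ge_arch (ord := ord) (r := r + beta * (wt x)%:R) eta_gt0) => j.
  have := hv j x; rewrite addrAC; congr (ord_ge _ _ _).
  rewrite -[LHS]/(v x - (\sum_(k < j) P (W k)) x) fct_sumE big1 ?subr0 // => k _.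
  exact: P_supp.
apply/eqP; rewrite -subr_eq0; apply/eqP.
apply: (norm_ge_eq0 (ord := ord) (wt := wt) (beta := beta) (r := r) eta_gt0) => j.
(* The recursion defining [W] telescopes; [d] is only compared with partial sums, and the remainders
   are handled by the norm. *)
have part i : d (\sum_(k < i) s (W k)) = w - W i - \sum_(k < i) P (W k).
  elim: i => [|i IH]; first by rewrite !big_ord0 d0 subrr subr0.
  rewrite !big_ord_recr /= dD IH !opprD !opprK.
  by apply/funext => x; rewrite !fctE /=; ring.
have -> : w - (d e + v) = W j - d (e - \sum_(k < j) s (W k)) - (v - \sum_(k < j) P (W k)).
  by rewrite dB part; apply/funext => x; rewrite !fctE /=; ring.
apply: (norm_geB hord); last exact: hv.
by apply: (norm_geB hord); [exact: Wr|apply: d_norm; exact: he].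
Qed.

(** The primitive can be improved by [eta] any number of times. First v = P(d e) - (P v - v) is
    small. Then e - d s e - P e is a primitive of the same v, and it equals s v minus the homotopy
    error, so it is small too. *)
Lemma perturbation_indep e v r : norm_ge r e -> supported v -> v = d e -> v = 0.
Proof.
move=> er vA ve.
apply: (norm_ge_eq0 (ord := ord) (wt := wt) (beta := beta) (r := r) eta_gt0) => j.
have {e er ve} [e er ->] : exists2 e, norm_ge (r + j%:R * eta) e & v = d e; last exact: d_norm.
elim: j => [|j [e' e'r ve']]; first by exists e; rewrite // mul0r addr0.
move: {e er ve} e' e'r ve' => e er ve; set t := r + _ in er.
rewrite -natr1 mulrDl mul1r addrA -/t.
have vr : norm_ge (t + eta) v.
  have -> : v = P (d e) - (P v - v) by rewrite -ve opprB addrC subrK.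
  apply: (norm_geB hord); first exact: Pd_small.
  by apply: P_id => //; rewrite ve; apply: d_norm.
exists (s v - (d (s e) + s (d e) - (e - P e))).
  by apply: (norm_geB hord); [exact: s_norm|exact: homotopy].
rewrite !dB dD dd0 (d_supp (P_supp _)) -ve add0r subr0.
by apply/funext => x; rewrite !fctE /=; ring.
Qed.

End Perturbation.

(** * Lifting a homotopy from the residue field *)

Section KernelOperators.
Variables (n e : nat) (A : comNzRingType).
Implicit Types (K : form_index n -> form_index n -> A) (w : form_index n -> A).

Lemma kernel_opB K v w : kernel_op e K (v - w) = kernel_op e K v - kernel_op e K w.
Proof.
apply/funext => x; rewrite !fctE /kernel_op -sumrB.
by apply: eq_bigr => y _; rewrite -mulrBl.
Qed.

Lemma kernel_op_comp K K' w : kernel_op e K' (kernel_op e K w) =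
  kernel_op e (fun z x => \sum_(y <- weight_fibre n e (weight e x)) K z y * K' y x) w.
Proof.
apply/funext => x; rewrite /kernel_op.
transitivity (\sum_(y <- weight_fibre n e (weight e x))
    \sum_(z <- weight_fibre n e (weight e x)) w z * K z y * K' y x).
  rewrite big_seq [RHS]big_seq; apply: eq_bigr => y.
  by rewrite mem_weight_fibre => /eqP ->; rewrite mulr_suml.
rewrite exchange_big; apply: eq_bigr => z _; rewrite mulr_sumr.
by apply: eq_bigr => y _; rewrite mulrA.
Qed.

Lemma kernel_op_id w : kernel_op e (fun z x => (z == x)%:R) w = w.
Proof.
apply/funext => x; rewrite /kernel_op (bigD1_seq x) ?weight_fibre_uniq //=; last first.
  by rewrite mem_weight_fibre.
by rewrite eqxx mulr1 big1 ?addr0 // => y /negPf->; rewrite mulr0.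
Qed.

Lemma kernel_op_kerD K K' w :
  kernel_op e K w + kernel_op e K' w = kernel_op e (fun z x => K z x + K' z x) w.
Proof.
apply/funext => x; rewrite !fctE /kernel_op -big_split.
by apply: eq_bigr => y _; rewrite mulrDr.
Qed.

Lemma kernel_op_kerB K K' w :
  kernel_op e K w - kernel_op e K' w = kernel_op e (fun z x => K z x - K' z x) w.
Proof.
apply/funext => x; rewrite !fctE /kernel_op -sumrB.
by apply: eq_bigr => y _; rewrite -mulrBr.
Qed.

End KernelOperators.

Section KernelNorm.
Variables (p : nat) (L : fieldType) (ord : L -> rat).
Hypothesis hord : padic_valuation p ord.
Variables (n e : nat) (beta : rat) (K : form_index n -> form_index n -> L) (t : rat).
Hypothesis K_ge : forall z x, weight e z = weight e x -> ord_ge ord t (K z x).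

Lemma kernel_op_norm r w : norm_ge ord (weight e) beta r w ->
  norm_ge ord (weight e) beta (r + t) (kernel_op e K w).
Proof.
move=> wr x; rewrite /kernel_op big_seq; apply: (ord_ge_sum hord) => y.
rewrite mem_weight_fibre => /eqP yx; rewrite addrAC -yx.
by apply: (ord_geM hord) => //; apply: K_ge.
Qed.

Lemma kernel_op_null w : norm_null ord (weight e) beta w ->
  norm_null ord (weight e) beta (kernel_op e K w).
Proof.
move=> wC r; have [k hk] := wC (r - t); exists k => x kx.
rewrite /kernel_op big_seq; apply: (ord_ge_sum hord) => y.
rewrite mem_weight_fibre => /eqP yx; rewrite -(subrK t r) addrAC -yx.
by apply: (ord_geM hord); [apply: hk; rewrite yx|apply: K_ge].
Qed.

End KernelNorm.

Section Lifting.
Variables (p : nat) (Qp : fieldType) (L : fieldExtType Qp) (ord : L -> rat).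
Hypothesis hord : padic_valuation p ord.
Variables (K : {subfield L}) (F : finFieldType) (red : L -> F).
Hypotheses (K_unramified : unramified ord K) (hred : residue_map ord K red).

(** A relation, since [red] is a morphism only on the integers of K; its closure under ring
    operations transports identities between kernels. *)
Definition lifts (x : L) (c : F) : Prop := [/\ x \in K, ord_ge ord 0 x & red x = c].

Lemma lifts0 : lifts 0 0.
Proof. by split; [exact: mem0v|exact: ord_ge0|apply/(red_eq0 hred)]; rewrite ?mem0v //; left. Qed.

Lemma lifts1 : lifts 1 1.
Proof. by split; [exact: mem1v|exact: (ord_ge1 hord)|apply: red1 hred]. Qed.

Lemma liftsD x y c d : lifts x c -> lifts y d -> lifts (x + y) (c + d).
Proof.
move=> [xK x0 <-] [yK y0 <-]; split; first exact: memvD.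
  exact: (ord_geD hord).
by rewrite (redD hred).
Qed.

Lemma liftsM x y c d : lifts x c -> lifts y d -> lifts (x * y) (c * d).
Proof.
move=> [xK x0 <-] [yK y0 <-]; split; first exact: memvM.
  exact: (ord_geM0 hord).
by rewrite (redM hred).
Qed.

Lemma liftsN x c : lifts x c -> lifts (- x) (- c).
Proof.
move=> [xK x0 <-]; have NK : - x \in K by rewrite memvN.
have N0 := ord_geN hord x0; split=> //.
apply/eqP; rewrite -addr_eq0 -(redD hred) // addNr.
by case: lifts0 => _ _ ->.
Qed.

Lemma lifts_sum I (s : seq I) (P : pred I) (f : I -> L) (g : I -> F) :
  (forall i, P i -> lifts (f i) (g i)) ->
  lifts (\sum_(i <- s | P i) f i) (\sum_(i <- s | P i) g i).
Proof.
move=> h; apply: big_ind2 => [|*|]; [exact: lifts0|exact: liftsD|exact: h].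
Qed.

Lemma lifts_sign k : lifts ((-1) ^+ k) ((-1) ^+ k).
Proof.
elim: k => [|k IH]; first exact: lifts1.
by rewrite !exprS; apply/liftsM => //; apply/liftsN/lifts1.
Qed.

Lemma lifts_nat (k : nat) : lifts k%:R k%:R.
Proof.
by elim: k => [|k IH]; [exact: lifts0|rewrite !mulrS; apply: liftsD => //; exact: lifts1].
Qed.

(** As K is unramified, a positive valuation in K is a positive integer. *)
Lemma lifts_eq0 x : lifts x 0 -> ord_ge ord 1 x.
Proof.
case=> xK x0 /(red_eq0 hred xK x0)[->|xp]; first exact: ord_ge0.
have [->|xn0] := eqVneq x 0; first exact: ord_ge0.
right; have /intrP[k kE] := K_unramified xK xn0.
by move: xp; rewrite kE ltr0z ler1z gtz0_ge1.
Qed.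

(** Zero goes to zero so that the lift of [P] still takes values supported on [A] exactly. *)
Lemma lift_section : exists sg : F -> L, sg 0 = 0 /\ forall c, lifts (sg c) c.
Proof.
have /choice[sg hsg] := red_surj hred.
exists (fun c => if c == 0 then 0 else sg c); rewrite eqxx; split=> // c.
by case: eqP => [->|_]; [exact: lifts0|apply: hsg].
Qed.

Lemma lifts_koszul_kernel n (g : 'I_n -> 'X_{1..n} -> L) (h : 'I_n -> 'X_{1..n} -> F) y x :
  (forall i k, lifts (g i k) (h i k)) ->
  lifts (koszul_kernel g y x) (koszul_kernel h y x).
Proof.
move=> gh; apply: lifts_sum => i _; apply: liftsM; first exact: lifts_sign.
by apply: lifts_sum => k _; apply: liftsM => //; apply: lifts_nat.
Qed.

Section LiftedPerturbation.
Hypothesis L_complete : ord_complete ord.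
Variables (n e : nat) (beta eta : rat).
Hypotheses (eta_gt0 : 0 < eta) (eta_le1 : eta <= 1).
Let norm_ge := norm_ge ord (weight (n := n) e) beta.
Let norm_null := norm_null ord (weight (n := n) e) beta.
Variable A : pred (form_index n).
Let supported (w : form_index n -> L) := forall x, ~~ A x -> w x = 0.
Variables (g : 'I_n -> 'X_{1..n} -> L) (h : 'I_n -> 'X_{1..n} -> F).
Hypotheses (gh : forall i k, lifts (g i k) (h i k))
  (g_homog : forall i k, mdeg k != e -> g i k = 0).
Variables s P : form_index n -> form_index n -> F.
Let Kh := koszul_kernel h.
Hypotheses
  (P_supp : forall y x, weight e y = weight e x -> ~~ A x -> P y x = 0)
  (sK : forall z x, weight e z = weight e x ->
     \sum_(y <- weight_fibre n e (weight e x)) s z y * Kh y x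
     + \sum_(y <- weight_fibre n e (weight e x)) Kh z y * s y x = (z == x)%:R - P z x)
  (KP : forall z x, weight e z = weight e x ->
     \sum_(y <- weight_fibre n e (weight e x)) Kh z y * P y x = 0)
  (P_id : forall y x, weight e y = weight e x -> A y -> P y x = (y == x)%:R).

Variable d : (form_index n -> L) -> form_index n -> L.
Hypotheses (dB : forall v w, d (v - w) = d v - d w)
  (d_null : forall w, norm_null w -> norm_null (d w))
  (dd0 : forall w, d (d w) = 0)
  (d_supp : forall w, supported w -> d w = 0)
  (d_koszul : forall r w, norm_ge r w -> norm_ge (r + eta) (d w - koszul g w)).

(** The entries of [s] and [P] are lifted one by one. Each approximate identity required by the
    perturbation lemmas has two errors: replacing [d] by [koszul g] gains [eta] by hypothesis, and
    the remaining kernel reduces to 0 in F, so it gains 1. *)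
Lemma lifted_perturbation :
  (forall w, norm_null w -> d w = 0 ->
     exists e v, [/\ norm_null e, supported v & w = d e + v])
  /\ (forall e v, norm_null e -> supported v -> v = d e -> v = 0).
Proof.
have [sg [sg0 sgl]] := lift_section.
pose s' := kernel_op e (fun y x => sg (s y x)).
pose P' := kernel_op e (fun y x => sg (P y x)).
pose Kg := koszul_kernel g.
have koszE w : koszul g w = kernel_op e Kg w.
  by apply/funext => x; apply: koszulE.
have Kgl z y : lifts (Kg z y) (Kh z y) by apply: lifts_koszul_kernel.
have sg_ge c : ord_ge ord 0 (sg c) by case: (sgl c).
have Kg_ge y x : ord_ge ord 0 (Kg y x) by case: (Kgl y x).
have norm0 M : (forall z x, ord_ge ord 0 (M z x)) ->
    forall r w, norm_ge r w -> norm_ge r (kernel_op e M w).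
  by move=> hM r w wr; rewrite -[r]addr0; apply: (kernel_op_norm hord).
have small M r w : (forall z x, weight e z = weight e x -> lifts (M z x) 0) ->
    norm_ge r w -> norm_ge (r + eta) (kernel_op e M w).
  move=> hM wr; apply: (@norm_geW _ _ _ _ _ (r + 1)); first by rewrite lerD2l.
  by apply: (kernel_op_norm hord) wr => z x /hM/lifts_eq0.
have eta_ge r w : norm_ge (r + eta) w -> norm_ge r w.
  by apply: norm_geW; rewrite lerDl ltW.
have d_norm r w : norm_ge r w -> norm_ge r (d w).
  move=> wr; rewrite -(subrK (koszul g w) (d w)); apply: (norm_geD hord).
    exact/eta_ge/d_koszul.
  by rewrite koszE; apply: norm0.
have P'_supp w : supported (P' w).
  move=> x Ax; rewrite /P' /kernel_op big_seq big1 // => y.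
  by rewrite mem_weight_fibre => /eqP yx; rewrite P_supp // sg0 mulr0.
have s'B v w : s' (v - w) = s' v - s' w by apply: kernel_opB.
have P'B v w : P' (v - w) = P' v - P' w by apply: kernel_opB.
have main1 r w : norm_ge r w -> norm_ge (r + eta) (d (s' w) + s' (d w) - (w - P' w)).
  move=> wr.
  have -> : d (s' w) + s' (d w) - (w - P' w) =
    (d (s' w) - koszul g (s' w)) + s' (d w - koszul g w)
     + (koszul g (s' w) + s' (koszul g w) - (w - P' w)).
    by rewrite s'B; apply/funext => x; rewrite !fctE /=; ring.
  apply: (norm_geD hord); first apply: (norm_geD hord).
  - by apply: d_koszul; apply: norm0.
  - by apply: norm0 => //; apply: d_koszul.
  rewrite !koszE /s' /P' -[X in _ - (X - _)](kernel_op_id e w).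
  rewrite !kernel_op_comp kernel_op_kerD !kernel_op_kerB.
  apply: small wr => z x zx; rewrite -(subrr ((z == x)%:R - P z x)) -{1}sK //.
  apply: liftsD; first by apply: liftsD; apply: lifts_sum => y _; apply: liftsM.
  by apply/liftsN/liftsD; [exact: lifts_nat|exact: liftsN].
have main2 r w : norm_ge r w -> norm_ge (r + eta) (P' (d w)).
  move=> wr; have -> : P' (d w) = P' (d w - koszul g w) + P' (koszul g w).
    by rewrite P'B subrK.
  apply: (norm_geD hord); first by apply: norm0 => //; apply: d_koszul.
  rewrite koszE /P' kernel_op_comp; apply: small wr => z x zx.
  by rewrite -(KP zx); apply: lifts_sum => y _; apply: liftsM.
have main3 r w : supported w -> norm_ge r w -> norm_ge (r + eta) (P' w - w).
  move=> wA wr; rewrite -[X in _ - X](kernel_op_id e w) kernel_op_kerB.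
  (* The kernel reduces to 0 only on the rows indexed by [A]; on the other rows [w] vanishes, so
     they may be set to 0. *)
  have -> : kernel_op e (fun z x => sg (P z x) - (z == x)%:R) w =
      kernel_op e (fun z x => if A z then sg (P z x) - (z == x)%:R else 0) w.
    apply/funext => x; apply: eq_bigr => z _; case: ifPn => // /wA->.
    by rewrite !mul0r.
  apply: small wr => z x zx; case: ifPn => [Az|_]; last exact: lifts0.
  rewrite -(subrr (P z x)) {3}P_id //; apply: liftsD => //.
  by apply: liftsN; apply: lifts_nat.
have s'_norm r w : norm_ge r w -> norm_ge r (s' w) by apply: norm0.
have P'_norm r w : norm_ge r w -> norm_ge r (P' w) by apply: norm0.
have mem_fib := @mem_weight_fibre n e.
split=> [w wC dw|v w vC wA wE].
- apply: (perturbation_exact hord L_complete mem_fib eta_gt0 (d := d) (s := s') (P := P')) => //.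
  + by move=> v vC; apply: (kernel_op_null hord) vC => z x _.
  + by move=> v vC; apply: (kernel_op_null hord) vC => z x _.
have [r vr] := norm_null_bounded mem_fib vC.
apply: (perturbation_indep hord eta_gt0 (d := d) (s := s') (P := P') (A := A)) wE => //.
- exact: d_norm.
- exact: s'_norm.
- exact: main1.
- exact: main2.
- exact: main3.
Qed.

End LiftedPerturbation.
End Lifting.

(** * Power series *)

Section SeriesAgreement.
Variables (L : fieldType) (n : nat).
Implicit Types (xi : 'X_{1..n} -> L^o) (q : {mpoly L[n]}).

(** Identities between series are deduced from identities between polynomials by truncation at every
    degree. *)
Definition agree (k : nat) xi q : Prop := forall u, (mdeg u < k)%N -> xi u = q@_u.

Lemma agree_exists k xi : exists q, agree k xi q.
Proof.
exists (\sum_(m : 'X_{1..n < k}) xi m *: 'X_[m]) => u uk.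
by rewrite mcoeff_mpoly.
Qed.

Lemma agree_ext xi xi' :
  (forall k, exists2 q, agree k xi q & agree k xi' q) -> xi = xi'.
Proof.
move=> h; apply/funext => u; have [q hq hq'] := h (mdeg u).+1.
by rewrite hq ?hq'.
Qed.

Lemma agreeD k xi xi' q q' : agree k xi q -> agree k xi' q' -> agree k (xi + xi') (q + q').
Proof. by move=> h h' u uk; rewrite mcoeffD -h // -h'. Qed.

Lemma agreeW k xi q : agree k.+1 xi q -> agree k xi q.
Proof. by move=> h u uk; apply: h; apply: ltnW. Qed.

End SeriesAgreement.

Section SeriesCalculus.
Variables (Qp : fieldType) (L : fieldExtType Qp) (n : nat).
Implicit Types (xi psi : series L n) (q : {mpoly L[n]}).

Lemma agreeM k xi xi' q q' : agree k xi q -> agree k xi' q' ->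
  agree k (series_mul xi xi') (q * q').
Proof.
move=> h h' u uk; rewrite mcoeffM; apply: eq_bigr => v /eqP uv.
have := congr1 (@mdeg n) uv; rewrite mdegD => ud.
by rewrite h ?h' //; lia.
Qed.

Lemma agree_deriv k i xi q : agree k.+1 xi q -> agree k (series_deriv i xi) (q^`M(i)).
Proof.
move=> h u uk; rewrite mcoeff_deriv /series_deriv h // mdegD mdeg1.
by rewrite addn1.
Qed.

(** Formally exp(-psi) d/dx_i exp(psi), whence the commutation proved below. *)
Definition twisted_deriv psi i xi : series L n :=
  series_deriv i xi + series_mul (series_deriv i psi) xi.

Lemma agree_twisted k psi i xi q s : agree k.+1 xi q -> agree k.+1 psi s ->
  agree k (twisted_deriv psi i xi) (q^`M(i) + s^`M(i) * q).
Proof.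
move=> h h'; apply: agreeD; first exact: agree_deriv.
by apply: agreeM; [exact: agree_deriv|exact: agreeW].
Qed.

Lemma twisted_deriv_comm psi i j xi :
  twisted_deriv psi i (twisted_deriv psi j xi) =
  twisted_deriv psi j (twisted_deriv psi i xi).
Proof.
apply: agree_ext => k.
(* Each of the two derivations costs one degree of precision. *)
have [q hq] := agree_exists k.+2 xi; have [s hs] := agree_exists k.+2 psi.
have main a b := agree_twisted a (agree_twisted b hq hs) (agreeW hs).
exists ((q^`M(j) + s^`M(j) * q)^`M(i) + s^`M(i) * (q^`M(j) + s^`M(j) * q)); first exact: main.
move=> u uk; rewrite (main j i) //; congr (_@_u).
rewrite !mderivD !mderivM (mderiv_comm i j q) (mderiv_comm i j s); ring.
Qed.

Lemma series_mulDr xi psi psi' : series_mul xi (psi + psi') =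
  series_mul xi psi + series_mul xi psi'.
Proof.
apply/funext => u; rewrite !fctE /series_mul -big_split /=.
by apply: eq_bigr => v _; rewrite mulrDr.
Qed.

Lemma series_mulZr xi a psi : series_mul xi (a *: psi) = a *: series_mul xi psi.
Proof.
apply/funext => u; rewrite !fctE /series_mul scaler_sumr.
by apply: eq_bigr => v _; rewrite /= mulrCA.
Qed.

Lemma series_mulBl xi xi' psi : series_mul (xi - xi') psi = series_mul xi psi - series_mul xi' psi.
Proof.
apply/funext => u; rewrite !fctE /series_mul -sumrB /=.
by apply: eq_bigr => v _; rewrite mulrBl.
Qed.

Lemma series_mulZl xi a psi : series_mul (a *: xi) psi = a *: series_mul xi psi.
Proof.
apply/funext => u; rewrite !fctE /series_mul scaler_sumr.
by apply: eq_bigr => v _; apply: esym; apply: mulrA.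
Qed.

Lemma twisted_deriv_linear psi i : linear (twisted_deriv psi i).
Proof.
move=> a xi xi'; rewrite /twisted_deriv series_mulDr series_mulZr scalerDr addrACA.
congr (_ + _); apply/funext => u; rewrite !fctE /series_deriv.
by rewrite mulrnDl scalerMnr.
Qed.

End SeriesCalculus.

Section SeriesNorm.
Variables (p : nat) (Qp : fieldType) (L : fieldExtType Qp) (ord : L -> rat) (n : nat).
Hypothesis hord : padic_valuation p ord.
Variable beta : rat.
Implicit Types (xi psi : series L n) (r t : rat).
Let norm_ge := norm_ge ord (@mdeg n) beta.
Let norm_null := norm_null ord (@mdeg n) beta.

Lemma series_deriv_norm r i xi : norm_ge r xi -> norm_ge (r + beta) (series_deriv i xi).
Proof.
move=> h u; apply: (ord_geMn hord); apply: ord_geW (h _).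
by rewrite mdegD mdeg1 natrD mulrDr mulr1 -addrA (addrC beta).
Qed.

Lemma series_deriv_null i xi : norm_null xi -> norm_null (series_deriv i xi).
Proof.
move=> h r; have [k hk] := h (r - beta); exists k => u uk.
apply: (ord_geMn hord); apply: ord_geW (hk _ _); rewrite mdegD mdeg1.
  by rewrite natrD mulrDr mulr1 [_ + beta]addrC addrA subrK.
by rewrite ltnW // addn1.
Qed.

Lemma series_mul_norm r t xi psi : norm_ge r xi -> norm_ge t psi ->
  norm_ge (r + t) (series_mul xi psi).
Proof.
move=> hx hp u; apply: (ord_ge_sum hord) => v /eqP uv.
have -> : r + t + beta * (mdeg u)%:R =
    (r + beta * (mdeg v.1)%:R) + (t + beta * (mdeg v.2)%:R).
  have -> : (mdeg u)%:R = (mdeg v.1)%:R + (mdeg v.2)%:R :> rat.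
    by rewrite -natrD -mdegD -uv.
  by ring.
exact: (ord_geM hord).
Qed.

Lemma series_null_bounded xi : norm_null xi -> exists r, norm_ge r xi.
Proof.
pose fib m := [seq x <- [seq val u | u <- enum {: 'X_{1..n < m.+1}}] | mdeg x == m].
apply: (@norm_null_bounded _ ord _ (@mdeg n) fib) => m x.
rewrite mem_filter andb_idr // => /eqP xm; apply/mapP.
have xm1 : (mdeg x < m.+1)%N by rewrite xm.
by exists (BMultinom xm1); rewrite ?mem_enum.
Qed.

(** In a product term of large degree one factor has large degree and is small, while the other is
    bounded. *)
Lemma series_mul_null xi psi : norm_null xi -> norm_null psi ->
  norm_null (series_mul xi psi).
Proof.
move=> hx hp r; have [rx bx] := series_null_bounded hx.
have [rp bp] := series_null_bounded hp.
have [kx hkx] := hx (r - rp); have [kp hkp] := hp (r - rx).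
exists (kx + kp)%N => u uk; apply: (ord_ge_sum hord) => v /eqP uv.
have uE : mdeg u = (mdeg v.1 + mdeg v.2)%N by rewrite -mdegD -uv.
have uR : (mdeg u)%:R = (mdeg v.1)%:R + (mdeg v.2)%:R :> rat by rewrite -natrD -uE.
have [vx|vx] := leqP kx (mdeg v.1).
  have -> : r + beta * (mdeg u)%:R =
      (r - rp + beta * (mdeg v.1)%:R) + (rp + beta * (mdeg v.2)%:R).
    by rewrite uR; ring.
  by apply: (ord_geM hord); [exact: hkx|exact: bp].
have -> : r + beta * (mdeg u)%:R =
    (rx + beta * (mdeg v.1)%:R) + (r - rx + beta * (mdeg v.2)%:R).
  by rewrite uR; ring.
by apply: (ord_geM hord); [exact: bx|apply: hkp; lia].
Qed.

Lemma series_scale_norm r a xi : a != 0 -> norm_ge r xi -> norm_ge (ord a + r) (a *: xi).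
Proof.
by move=> a0 h u; rewrite -addrA; apply: (ord_geM hord) => //; apply: ord_ge_refl.
Qed.

Lemma series_scale_null a xi : norm_null xi -> norm_null (a *: xi).
Proof.
have [->|a0] := eqVneq a 0.
  by move=> _; rewrite scale0r; apply: norm_null0.
move=> h r; have [k hk] := h (r - ord a); exists k => u /hk uk.
have -> : r + beta * (mdeg u)%:R = ord a + (r - ord a + beta * (mdeg u)%:R) by ring.
by apply: (ord_geM hord) => //; apply: ord_ge_refl.
Qed.

End SeriesNorm.

(** * The series H_i *)

Section PowerSubstitution.
Variables (R : comNzRingType) (n : nat).
Implicit Types (P : {mpoly R[n]}).

Definition power_subst (q : nat) P : {mpoly R[n]} := P \mPo [tuple 'X_j ^+ q | j < n].

Lemma power_substX q m : power_subst q 'X_[R, m] = 'X_[(m *+ q)%MM].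
Proof.
rewrite /power_subst comp_mpolyX mpolyXE_id; apply: eq_bigr => i _.
by rewrite tnth_mktuple -exprM mulmnE mulnC.
Qed.

Lemma power_substE q P :
  power_subst q P = \sum_(m <- msupp P) P@_m *: 'X_[(m *+ q)%MM].
Proof. by rewrite /power_subst comp_mpolyEX; apply: eq_bigr => m _; rewrite -power_substX. Qed.

Lemma mcoeff_power_subst q P m : (0 < q)%N -> (power_subst q P)@_(m *+ q) = P@_m.
Proof.
move=> q0; rewrite power_substE raddf_sum /= [in RHS](mpolyE P) raddf_sum /=.
apply: eq_bigr => k _; rewrite !mcoeffZ !mcoeffX; congr (_ * _%:R).
congr nat_of_bool; apply/eqP/eqP => [/mnmP h|->//]; apply/mnmP => i.
by have := h i; rewrite !mulmnE => /eqP; rewrite eqn_pmul2r // => /eqP.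
Qed.

Lemma mcoeff_power_subst_eq0 q P v : (forall m, v != (m *+ q)%MM) ->
  (power_subst q P)@_v = 0.
Proof.
move=> hv; rewrite power_substE raddf_sum /= big1 // => m _.
by rewrite mcoeffZ mcoeffX eq_sym (negPf (hv m)) mulr0.
Qed.

Lemma deriv_power_subst q P i : (0 < q)%N ->
  (power_subst q P)^`M(i) = ('X_i ^+ q.-1 * power_subst q P^`M(i)) *+ q.
Proof.
move=> q0; have -> : power_subst q P^`M(i) =
    \sum_(m <- msupp P) ((m i)%:R * P@_m) *: 'X_[((m - U_(i)) *+ q)%MM].
  rewrite /power_subst {1}/mderiv raddf_sum; apply: eq_bigr => m _.
  by rewrite /= comp_mpolyZ -/(power_subst _ _) power_substX.
rewrite power_substE raddf_sum /= mulr_sumr -sumrMnl; apply: eq_bigr => m _.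
rewrite mderivZ mderivX -scalerAr scalerMnr [_%:R * _]mulrC -[in RHS]scalerA; congr (_ *: _).
(* For m_i = 0 the truncated difference m - U_i is meaningless, but its coefficient vanishes. *)
have [m0|m0] := posnP (m i); first by rewrite mulmnE m0 mul0n !scale0r.
rewrite mulmnE natrM mpolyXn -mpolyXD -scaler_nat scalerA; congr (_ *: 'X_[_]).
apply/mnmP => k; rewrite mnmBE mnmDE !mulmnE mnmBE mnm1E; case: eqP => [<-|_] /=; last by lia.
by rewrite mul1n mulnBl mul1n; case: (m i) m0 => // a _; rewrite mulSn; lia.
Qed.

End PowerSubstitution.

Section DworkSeries.
Variables (p d n : nat) (Qp : fieldType) (L : fieldExtType Qp) (ord : L -> rat).
Hypotheses (hp : prime p) (hord : padic_valuation p ord).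
Variables (gamma : L) (tau : 'End(L)) (fhat : {mpoly L[n]}).
Hypotheses (gamma_root : ord_cvg ord (gammal p gamma) 0)
  (gamma_neq0 : gamma != 0) (ord_gamma : ord gamma = 1 / (p%:R - 1)).
Hypotheses (fhat_int : forall l m, ord_ge ord 0 (iter l tau fhat@_m))
  (fhat_deg : forall m, (d < mdeg m)%N -> fhat@_m = 0).

(** Recovers the additive structure that the coefficient rule for [map_mpoly] asks for. *)
Let iter_lfun l : exists g : 'End(L), iter l tau = g.
Proof.
exists (iter l (comp_lfun tau) \1%VF); apply/funext => x.
by elim: l => [|l IH] /=; [rewrite id_lfunE|rewrite comp_lfunE IH].
Qed.

Definition Dwork_term (l : nat) : {mpoly L[n]} :=
  gammal p gamma l *: power_subst (p ^ l) (map_mpoly (iter l tau) fhat).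

Lemma Hterm_deriv i l : Hterm p gamma tau fhat i l = (Dwork_term l)^`M(i).
Proof.
have q0 : (0 < p ^ l)%N by rewrite expn_gt0 prime_gt0.
rewrite /Dwork_term mderivZ deriv_power_subst // -scaler_nat scalerA natrX.
rewrite /Hterm -/(power_subst _ _); congr (_ *: (_ * power_subst _ _)).
have [g ->] := iter_lfun l; apply/mpolyP => m.
by rewrite mcoeff_map_mpoly !mcoeff_deriv mcoeff_map_mpoly raddfMn.
Qed.

(* H_i is the i-th partial derivative of \sum_l gamma_l fhat^(tau^l)(x^(p^l)); a
   monomial x^v with v <> 0 occurs only in the terms [l < mdeg v]. *)
Definition Dwork_potential : series L n := fun v => \sum_(l < mdeg v) (Dwork_term l)@_v.

Lemma Hseries_deriv i : Hseries p gamma tau fhat i = series_deriv i Dwork_potential.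
Proof.
apply/funext => u; rewrite /series_deriv /Dwork_potential mdegD mdeg1 addn1 -sumrMnl.
rewrite /Hseries; under [RHS]eq_bigr do rewrite -mcoeff_deriv -Hterm_deriv.
(* The two sums stop at different places, u_i and |u|; the extra terms vanish by [Hterm_coef0]. *)
have ui : ((u i).+1 <= (mdeg u).+1)%N by rewrite ltnS mdegE (bigD1 i) //= leq_addr.
rewrite (big_ord_widen _ (fun l => (Hterm p gamma tau fhat i l)@_u) ui).
rewrite big_mkcond; apply: eq_bigr => l _; case: ltnP => // ul.
by rewrite Hterm_coef0 ?prime_gt1.
Qed.

Let lam : rat := 1 / (p%:R - 1).

Let p_gt1 : 1 < p%:R :> rat.
Proof. by rewrite ltr1n prime_gt1. Qed.

Let lamE : lam * (p%:R - 1) = 1.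
Proof. by rewrite /lam divfK // subr_eq0 gt_eqF. Qed.

Let ord_gamma_pow i : ord (gamma ^+ (p ^ i) / p%:R ^+ i) = lam * (p ^ i)%:R - i%:R.
Proof.
have p0 := p_neq0 hord.
rewrite (ordM hord) ?expf_neq0 ?invr_eq0 ?expf_neq0 // (ordV hord) ?expf_neq0 //.
by rewrite !(ordX hord) // (ord_p hord) ord_gamma -[_ *+ (p ^ i)]mulr_natr.
Qed.

(* As the full series vanishes, [gammal l] is minus its tail, whose first term
   dominates. *)
Lemma gammal_ord l : ord_ge ord (lam * (p ^ l.+1)%:R - l.+1%:R) (gammal p gamma l).
Proof.
(* From exponent k to k+1 the valuation lam p^k - k grows by p^k - 1, because lam (p-1) = 1. *)
set r := _ - _; have mono i : r <= lam * (p ^ (l.+1 + i))%:R - (l.+1 + i)%:R.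
  elim: i => [|i]; first by rewrite addn0.
  move=> /le_trans; apply; rewrite addnS expnS natrM -natr1.
  have : 1 <= (p ^ (l.+1 + i))%:R :> rat by rewrite ler1n expn_gt0 prime_gt0.
  move: lamE; set P : rat := p%:R; set Q : rat := (_ ^ _)%:R; set J : rat := _%:R => lP Q1.
  have -> : lam * (P * Q) = lam * Q + Q by rewrite -[X in _ + X]mul1r -lP; ring.
  by lra.
have [k hk] := gamma_root r; have := hk (l.+1 + k)%N (leq_addl _ _).
rewrite subr0 /gammal -(big_mkord xpredT (fun i => gamma ^+ (p ^ i) / p%:R ^+ i)).
rewrite (@big_cat_nat _ _ _ l.+1) //=; last by rewrite -addnS leq_addr.
rewrite big_mkord => h; rewrite -[X in ord_ge _ _ X](addrK (\sum_(l.+1 <= i < (l.+1 + k).+1)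
  gamma ^+ (p ^ i) / p%:R ^+ i)).
apply: (ord_geB hord) h _; rewrite big_nat; apply: (ord_ge_sum hord) => i /andP[li _].
by right; rewrite ord_gamma_pow -(subnKC li); apply: mono.
Qed.

(** A nonzero coefficient forces u + U_i = p^l m with |m| <= d. The derivation then produces the
    factor u_i + 1, divisible by p^l, which turns the -(l+1) in the bound on [gammal] into -1. *)
Lemma Hterm_bound i l u : (Hterm p gamma tau fhat i l)@_u = 0 \/
  ((mdeg u).+1 <= d * p ^ l)%N /\
  ord_ge ord (lam * (p ^ l.+1)%:R - 1) (Hterm p gamma tau fhat i l)@_u.
Proof.
have q0 : (0 < p ^ l)%N by rewrite expn_gt0 prime_gt0.
rewrite Hterm_deriv mcoeff_deriv /Dwork_term mcoeffZ.
have [[m vE]|nv] := pselect (exists m, (u + U_(i))%MM = (m *+ p ^ l)%MM); last first.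
  left; rewrite mcoeff_power_subst_eq0 ?mulr0 ?mul0rn // => m.
  by apply/eqP => vE; apply: nv; exists m.
have [md|md] := leqP (mdeg m) d; last first.
  left; rewrite vE mcoeff_power_subst //; have [g E] := iter_lfun l.
  by rewrite E mcoeff_map_mpoly fhat_deg // raddf0 mulr0 mul0rn.
right; split.
  by have := congr1 (@mdeg n) vE; rewrite mdegD mdeg1 addn1 mdegMn => ->; rewrite leq_mul2r md orbT.
have uE : ((u i).+1 = m i * p ^ l)%N.
  by have /mnmP/(_ i) := vE; rewrite mnmDE mnm1E eqxx addn1 mulmnE.
rewrite -[X in ord_ge _ _ X]mulr_natr uE.
have -> : lam * (p ^ l.+1)%:R - 1 = (lam * (p ^ l.+1)%:R - l.+1%:R) + l%:R.
  by rewrite -natr1; ring.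
apply: (ord_geM hord); last by apply: (ord_ge_dvd hord); apply: dvdn_mull.
rewrite -[X in ord_ge _ X]addr0; apply: (ord_geM hord); first exact: gammal_ord.
rewrite vE mcoeff_power_subst //; have [g E] := iter_lfun l.
by rewrite E mcoeff_map_mpoly; have := fhat_int l m; rewrite E.
Qed.

Lemma Hterm0 i u : (Hterm p gamma tau fhat i 0)@_u =
  gamma * (fhat@_(u + U_(i)) *+ (u i).+1).
Proof.
rewrite Hterm_deriv mcoeff_deriv /Dwork_term mcoeffZ /gammal big_ord1 !expn0 expr1 expr0 divr1.
have -> : (u + U_(i))%MM = ((u + U_(i)) *+ 1)%MM by apply/mnmP => j; rewrite mulmnE muln1.
rewrite mcoeff_power_subst // mulrnAr; congr (_ * _ *+ _).
have [g E] := iter_lfun 0; rewrite E mcoeff_map_mpoly.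
by rewrite -[LHS]/((g : L -> L) _) -E.
Qed.

Variable b : rat.
Hypotheses (d_gt0 : (0 < d)%N) (b_gt0 : 0 < b) (b_lt : b < p%:R / (p%:R - 1)).
Let beta : rat := b / d%:R.

Let dq0 : 0 < d%:R :> rat. Proof. by rewrite ltr0n. Qed.
Let betaE : beta * d%:R = b. Proof. by rewrite /beta divfK ?gt_eqF. Qed.
Let beta_gt0 : 0 < beta. Proof. exact: divr_gt0. Qed.

Let gap : rat := p%:R * lam - b.
Let gap_gt0 : 0 < gap.
Proof. by rewrite subr_gt0 /lam mul1r. Qed.

(* The valuation gained, respectively, by the error terms of the lift modulo p, by
   the derivation and the terms of lower degree of [fhat], and by the terms
   [l >= 1] of the H_i. *)
Definition gain : rat := Num.min 1 (Num.min beta gap).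

Lemma gain_gt0 : 0 < gain. Proof. by rewrite !lt_min ltr01 beta_gt0 gap_gt0. Qed.
Lemma gain_le1 : gain <= 1. Proof. by rewrite ge_min lexx. Qed.
Lemma gain_le_beta : gain <= beta. Proof. by rewrite !ge_min lexx orbT. Qed.
Let gain_gap : gain <= gap. Proof. by rewrite !ge_min lexx !orbT. Qed.

Definition leading_deriv (i : 'I_n) (u : 'X_{1..n}) : L :=
  if mdeg u == d.-1 then fhat@_(u + U_(i)) *+ (u i).+1 else 0.

(** The l = 0 terms other than the leading ones have degree at most d-2, which gains beta. For l >=
    1 put Q = p^l: as 1 + lam = p lam, the valuation is at least p lam (Q-1), and beta (|u|+1) <= b
    Q. The gain is therefore at least (p lam - b)(Q-1), with Q >= 2. *)
Lemma Hseries_leading i : norm_ge ord (@mdeg n) beta (gain - beta * d.-1%:R)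
  (gamma^-1 *: Hseries p gamma tau fhat i - leading_deriv i : series L n).
Proof.
have dE : d.-1%:R = d%:R - 1 :> rat by rewrite -{2}(prednK d_gt0) -natr1 addrK.
have scE (a x : L) : a *: (x : L^o) = a * x by [].
move=> u; rewrite !fctE /Hseries big_ord_recl scE mulrDr [X in ord_ge _ _ X]addrAC.
apply: (ord_geD hord).
  rewrite (Hterm0 i u) (mulKf gamma_neq0) /leading_deriv.
  case: (mdeg u =P d.-1) => ud; first by rewrite subrr; apply: ord_ge0.
  rewrite subr0; have [du|du] := ltnP d (mdeg u).+1.
    by rewrite fhat_deg ?mul0rn ?mdegD ?mdeg1 ?addn1 //; apply: ord_ge0.
  apply: (ord_geMn hord); apply: ord_geW (fhat_int 0 _).
  have : (mdeg u)%:R + 2 <= d%:R :> rat.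
    rewrite -natrD ler_nat addn2 -(prednK d_gt0) ltnS ltn_neqAle.
    by apply/andP; split; [apply/eqP|rewrite -ltnS prednK].
  rewrite dE -(ler_pM2l beta_gt0) => h; move: gain_le_beta h.
  rewrite mulrDr !mulrBr mulr1 => h h'.
  by lra.
rewrite mulr_sumr; apply: (ord_ge_sum hord) => l _.
have [->|[ud hb]] := Hterm_bound i (lift ord0 l) u; first by rewrite mulr0; apply: ord_ge0.
have := ord_geM hord (ord_ge_refl ord gamma^-1) hb; apply: ord_geW.
rewrite (ordV hord) // ord_gamma -/lam; move: ud; rewrite /= /bump /= add1n => ud.
have Q2 : 2 <= (p ^ l.+1)%:R :> rat.
  by rewrite ler_nat; apply: leq_trans (prime_gt1 hp) _; rewrite -{1}[p]expn1 leq_exp2l ?prime_gt1.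
have : beta * ((mdeg u).+1)%:R <= beta * (d * p ^ l.+1)%:R.
  by rewrite ler_pM2l // ler_nat.
rewrite natrM mulrA betaE -natr1 mulrDr mulr1 => h1.
rewrite dE mulrBr mulr1 betaE (expnS p l.+1) natrM.
move: Q2 h1 gain_gap gap_gt0 lamE; rewrite /gap.
set Q : rat := (_ ^ _)%:R; set P : rat := p%:R; set U : rat := (mdeg u)%:R => Q2 h1 h2 h3 h4.
have h5 : (P * lam - b) * (Q - 1) >= P * lam - b.
  by apply: ler_peMr; [exact: ltW|rewrite lerBrDr].
have h6 : lam * (P * Q) = (P * lam) * Q by ring.
by rewrite h6; lra.
Qed.

(** The excess of the l-th term over beta |u| is at least gap p^l - 1, and p^l >= (|u|+1)/d; this
    bound tends to infinity with |u| uniformly in l. *)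
Lemma Hseries_null i : norm_null ord (@mdeg n) beta (Hseries p gamma tau fhat i : series L n).
Proof.
move=> r; pose k := Num.bound (`|(r + 1) * d%:R / gap|).
exists k => u ku; apply: (ord_ge_sum hord) => l _.
have [->|[ud]] := Hterm_bound i l u; first exact: ord_ge0.
apply: ord_geW; rewrite expnS natrM.
have hk : (r + 1) * d%:R / gap <= (mdeg u).+1%:R.
  apply: le_trans (ler_norm _) _; apply/ltW/(lt_le_trans (archi_boundP _)) => //.
  by rewrite ler_nat leqW.
have h0 : (mdeg u).+1%:R <= d%:R * (p ^ l)%:R :> rat by rewrite -natrM ler_nat.
have : beta * (mdeg u).+1%:R <= beta * (d%:R * (p ^ l)%:R) by rewrite ler_pM2l.
rewrite mulrA betaE -natr1 mulrDr mulr1 => h1.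
have : r + 1 <= gap * (p ^ l)%:R.
  rewrite -(ler_pM2r dq0); have := le_trans hk h0; rewrite ler_pdivrMr //.
  by congr (_ <= _); ring.
move: h1 beta_gt0; rewrite /gap; set Q : rat := (p ^ l)%:R; set P : rat := p%:R => h1 h2 h3.
have -> : lam * (P * Q) = P * lam * Q by ring.
by move: h3; rewrite mulrBl; lra.
Qed.

Definition scaled_Dop (i : 'I_n) (xi : series L n) : series L n :=
  gamma^-1 *: Dop p gamma tau fhat i xi.

Let DopE i xi : Dop p gamma tau fhat i xi = twisted_deriv Dwork_potential i xi.
Proof. by rewrite /Dop Hseries_deriv. Qed.

Lemma scaled_Dop_linear i : linear (scaled_Dop i).
Proof.
move=> a xi xi'; rewrite /scaled_Dop !DopE twisted_deriv_linear scalerDr !scalerA.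
by rewrite mulrC.
Qed.

Lemma scaled_Dop_comm i j xi :
  scaled_Dop i (scaled_Dop j xi) = scaled_Dop j (scaled_Dop i xi).
Proof.
have Z k c xi' : twisted_deriv Dwork_potential k (c *: xi') =
    c *: twisted_deriv Dwork_potential k xi'.
  exact: (scalable_linear (twisted_deriv_linear _ k)).
by rewrite /scaled_Dop !DopE !Z twisted_deriv_comm.
Qed.

Lemma scaled_Dop_null i xi : norm_null ord (@mdeg n) beta xi ->
  norm_null ord (@mdeg n) beta (scaled_Dop i xi).
Proof.
move=> hxi; apply: (series_scale_null hord); apply: (norm_nullD hord).
  exact: (series_deriv_null hord).
exact: (series_mul_null hord (Hseries_null i)) hxi.
Qed.

Hypothesis lam_le : lam <= beta * d.-1%:R.

(** The derivation gains beta by lowering the degree and gamma^-1 costs lam; [lam_le] keeps the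
    total within gain - beta (d-1). *)
Lemma scaled_Dop_leading i r xi : norm_ge ord (@mdeg n) beta r xi ->
  norm_ge ord (@mdeg n) beta (r + (gain - beta * d.-1%:R))
    (scaled_Dop i xi - series_mul (leading_deriv i) xi).
Proof.
move=> hxi; have -> : scaled_Dop i xi - series_mul (leading_deriv i) xi =
    gamma^-1 *: series_deriv i xi +
    series_mul (gamma^-1 *: Hseries p gamma tau fhat i - leading_deriv i) xi.
  by rewrite /scaled_Dop scalerDr series_mulBl series_mulZl -addrA.
apply: (norm_geD hord); last first.
  by rewrite addrC; apply: (series_mul_norm hord) hxi; apply: Hseries_leading.
have := series_scale_norm hord (invr_neq0 gamma_neq0) (series_deriv_norm hord i hxi).
apply: norm_geW; rewrite (ordV hord) // ord_gamma -/lam.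
by have := gain_le_beta; move: lam_le; lra.
Qed.

End DworkSeries.

(** * Cohomology of the forms over C(b) *)

Section FormsOfSeries.
Variables (p : nat) (Qp : fieldType) (L : fieldExtType Qp) (ord : L -> rat).
Hypotheses (hord : padic_valuation p ord) (L_complete : ord_complete ord).
Variables (K : {subfield L}) (F : finFieldType) (red : L -> F).
Hypotheses (K_unramified : unramified ord K) (hred : residue_map ord K red).
Variables (n e : nat) (beta eta : rat).
Hypotheses (eta_gt0 : 0 < eta) (eta_le1 : eta <= 1).
Variables (G : 'I_n -> {mpoly F[n]}) (N : nat) (mu : 'I_N -> 'X_{1..n}).
Hypotheses (n_gt0 : (0 < n)%N)
  (G_homog : forall i k, mdeg k != e -> (G i)@_k = 0)
  (G_reg : regular_sequence G)
  (mu_basis : cohomology_basis (fun _ : {mpoly F[n]} => True)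
     (wedge_diff (fun i g => G i * g)) n (fun i => top_form n 'X_[mu i])).
Variable g : 'I_n -> series L n.
Hypotheses (g_lifts : forall i k, lifts ord K red (g i k) (G i)@_k)
  (g_homog : forall i k, mdeg k != e -> g i k = 0).
Variable T : 'I_n -> series L n -> series L n.
Let null := norm_null ord (@mdeg n) beta.
Let norm := norm_ge ord (@mdeg n) beta.
Hypotheses (T_linear : forall i, linear (T i))
  (T_comm : forall i j xi, T i (T j xi) = T j (T i xi))
  (T_null : forall i xi, null xi -> null (T i xi))
  (T_leading : forall i r xi, norm r xi ->
     norm (r + (eta - beta * e%:R)) (T i xi - series_mul (g i) xi)).
Implicit Types (w : diff_form (series L n) n) (v : form_index n -> L).

Let flat w : form_index n -> L := fun x => w x.2 x.1.
Let unflat (v : form_index n -> L) : diff_form (series L n) n :=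
  [ffun S => (fun u => v (u, S)) : series L n].

Let flatK w : unflat (flat w) = w.
Proof. by apply/ffunP => S; rewrite ffunE. Qed.

(** Weight and degree differ by a constant on each S, and there are finitely many S. *)
Let null_flat v : norm_null ord (weight e) beta v <->
  forall S, null (fun u => v (u, S)).
Proof.
split=> [h S r|h r].
  have [k hk] := h (r - beta * (e * #|~: S|)%:R); exists k => u uk.
  have := hk (u, S) (leq_trans uk (leq_addr _ _)).
  by rewrite /weight natrD mulrDr; congr (ord_ge _ _ _); rewrite /=; ring.
have /choice[k hk] S := h S (r + beta * (e * #|~: S|)%:R).
exists (\max_S (k S + e * #|~: S|))%N => -[u S]; rewrite /weight /= => ux.
have ukS : (k S <= mdeg u)%N.
  rewrite -(leq_add2r (e * #|~: S|)); apply: leq_trans ux.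
  exact: (leq_bigmax (F := fun S => (k S + e * #|~: S|)%N)).
have := hk S u ukS.
by rewrite natrD mulrDr; congr (ord_ge _ _ _); ring.
Qed.

Let d (v : form_index n -> L) := flat (wedge_diff T (unflat v)).

Let dE v u S : d v (u, S) =
  \sum_(i in S) (-1) ^+ below S i * T i (fun u' => v (u', S :\ i)) u.
Proof.
rewrite /d /flat ffunE fct_sumE; apply: eq_bigr => i _ /=.
by rewrite ffunE.
Qed.

Let d_null v : norm_null ord (weight e) beta v -> norm_null ord (weight e) beta (d v).
Proof.
move=> /null_flat hv; apply/null_flat => S.
have -> : (fun u => d v (u, S)) =
    \sum_(i in S) (-1) ^+ below S i *: (T i (fun u' => v (u', S :\ i)) : series L n).
  by apply/funext => u; rewrite dE fct_sumE.
apply: (norm_null_sum hord) => i _; apply: (series_scale_null hord).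
exact: T_null.
Qed.

(* Forms are measured by their [weight] rather than by the degree of their
   coefficients, so that wedging with the leading 1-form preserves the norm. *)
Let d_koszul r v : norm_ge ord (weight e) beta r v ->
  norm_ge ord (weight e) beta (r + eta) (d v - koszul g v).
Proof.
move=> hv [u S]; rewrite !fctE dE /koszul /= -sumrB; apply: (ord_ge_sum hord) => i iS.
rewrite -mulrBr; apply: (ord_ge_sign hord).
pose xi : series L n := fun u' => v (u', S :\ i).
have hxi : norm (r + beta * (e * #|~: (S :\ i)|)%:R) xi.
  move=> u'; have := hv (u', S :\ i).
  by rewrite /weight /= natrD mulrDr; congr (ord_ge _ _ _); ring.
have := T_leading i hxi u; congr (ord_ge _ _ _).
have -> : (#|~: (S :\ i)| = #|~: S|.+1)%N.
  by rewrite setCD setUC cardsU1 inE iS.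
by rewrite /weight /= mulnS !natrD; ring.
Qed.

Let d_supp v : (forall x, ~~ basis_index mu x -> v x = 0) -> d v = 0.
Proof.
move=> hv; suff -> : v = flat (top_form n (fun u => v (u, setT))).
  by rewrite /d flatK wedge_diff_top //; apply/funext => x; rewrite /flat ffunE.
apply/funext => -[u S]; rewrite /flat ffunE /=; case: eqP => [->//|/eqP ST].
by apply: hv; rewrite /basis_index (negPf ST).
Qed.

Lemma series_cohomology :
  (forall w, (forall S, null (w S)) -> wedge_diff T w = 0 ->
     exists w1 w2, [/\ forall S, null (w1 S),
       forall S u, ~~ basis_index mu (u, S) -> w2 S u = 0 & w = wedge_diff T w1 + w2])
  /\ (forall w1 w2, (forall S, null (w1 S)) ->
       (forall S u, ~~ basis_index mu (u, S) -> w2 S u = 0) ->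
       w2 = wedge_diff T w1 -> w2 = 0).
Proof.
have [s [P [P0 sK KP Pid]]] := polynomial_homotopy G_homog n_gt0 G_reg mu_basis.
have dB v v' : d (v - v') = d v - d v'.
  rewrite /d; have -> : unflat (v - v') = (-1) *: unflat v' + unflat v.
    by apply/ffunP => S; apply/funext => u; rewrite !ffunE !fctE scaleN1r addrC.
  rewrite wedge_diff_linear // scaleN1r addrC; apply/funext => -[u S].
  by rewrite /flat ffunE [X in _ + X]ffunE.
have dd0 v : d (d v) = 0.
  rewrite /d flatK wedge_diff_comp0 //.
  by apply/funext => x; rewrite /flat ffunE.
have [h1 h2] := lifted_perturbation hord K_unramified hred L_complete eta_gt0 eta_le1
  (A := basis_index mu) (h := fun i k => (G i)@_k) g_lifts g_homog P0 sK KP Pid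
  dB d_null dd0 d_supp d_koszul.
split=> [w wC dw|w w2 wC vA vE].
  have [||w' [v [w'C vA wE]]] := h1 (flat w).
  - by apply/null_flat.
  - by rewrite /d flatK dw; apply/funext => x; rewrite /flat ffunE.
  exists (unflat w'), (unflat v); split=> [S|S u Au|].
  - by rewrite ffunE; move/null_flat: w'C; apply.
  - by rewrite ffunE; apply: vA.
  rewrite -[w]flatK wE; apply/ffunP => S; apply/funext => u.
  by rewrite !ffunE !fctE /d /flat !ffunE.
rewrite -[w2]flatK; have -> : flat w2 = 0.
  apply: (h2 (flat w)); first exact/null_flat.
    by move=> -[u S]; apply: vA.
  by rewrite /d flatK -vE.
by apply/ffunP => S; apply/funext => u; rewrite !ffunE.
Qed.

End FormsOfSeries.

(** * From a splitting of cocycles to cohomology in each degree *)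

Section CohomologyOfSplitting.
Variables (Qp : fieldType) (L : fieldExtType Qp) (n N : nat) (mu : 'I_N -> 'X_{1..n}).
Hypotheses (n_gt0 : (0 < n)%N) (mu_inj : injective mu).
Variable C : series L n -> Prop.
Hypotheses (C0 : C 0) (CZ : forall a xi, C xi -> C (a *: xi))
  (C_mu : forall i, C (monomial L (mu i))).
Variables (T : 'I_n -> series L n -> series L n) (c : L).
Variable delta : diff_form (series L n) n -> diff_form (series L n) n.
Hypotheses (T_linear : forall i, linear (T i)) (c_neq0 : c != 0)
  (deltaE : forall w, delta w = c *: wedge_diff T w).
Implicit Types w : diff_form (series L n) n.
Hypothesis split_cocycle : forall w, (forall S, C (w S)) -> wedge_diff T w = 0 ->
  exists w1 w2, [/\ forall S, C (w1 S),
    forall S u, ~~ basis_index mu (u, S) -> w2 S u = 0 & w = wedge_diff T w1 + w2].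
Hypothesis split_indep : forall w1 w2, (forall S, C (w1 S)) ->
  (forall S u, ~~ basis_index mu (u, S) -> w2 S u = 0) ->
  w2 = wedge_diff T w1 -> w2 = 0.

Let wTZ a w : wedge_diff T (a *: w) = a *: wedge_diff T w.
Proof. exact: (scalable_linear (wedge_diff_linear T_linear)). Qed.

Let form_C k w : is_form C k w -> forall S, C (w S).
Proof. by move=> h S; have := h S; case: eqP => _ // ->. Qed.

Let form_partE k w : is_form C k w -> form_part k w = w.
Proof. by move=> h; apply/ffunP => S; rewrite ffunE; have := h S; case: eqP. Qed.

Let card_setT (S : {set 'I_n}) : (#|S| == n) = (S == setT).
Proof.
by rewrite eqEcard subsetT cardsT card_ord eqn_leq -[X in (_ <= X)%N]card_ord max_card.
Qed.

Let coboundary_part k w : (forall S, C (w S)) ->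
  coboundary C delta k (form_part k (wedge_diff T w)).
Proof.
move=> wC; case: k => [|k] /=.
  apply/ffunP => S; rewrite !ffunE; case: eqP => // /cards0_eq ->.
  by rewrite big_set0.
exists (c^-1 *: form_part k w); last first.
  by rewrite deltaE wTZ scalerA mulfV // scale1r wedge_diff_part.
by move=> S; rewrite !ffunE; case: eqP => _; [apply: CZ|rewrite scaler0].
Qed.

Let split_part k w : cocycle C delta k w -> exists w1 w2,
  [/\ forall S, C (w1 S), forall S u, ~~ basis_index mu (u, S) -> w2 S u = 0
    & w = form_part k (wedge_diff T w1) + form_part k w2].
Proof.
case=> wf; rewrite deltaE => /eqP; rewrite scaler_eq0 (negPf c_neq0) /= => /eqP wT.
have [w1 [w2 [w1C w2A wE]]] := split_cocycle (form_C wf) wT; exists w1, w2; split=> //.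
rewrite -{1}(form_partE wf) wE; apply/ffunP => S; rewrite !ffunE.
by case: eqP => _; rewrite ?addr0.
Qed.

Let basis_sum (a : 'I_N -> L) S u :
  (\sum_i a i *: top_form n (monomial L (mu i))) S u =
  if S == setT then \sum_i a i * (u == mu i)%:R else 0.
Proof.
rewrite sum_ffunE fct_sumE; case: eqP => ST.
  by apply: eq_bigr => i _; rewrite !ffunE ST eqxx.
by rewrite big1 // => i _; rewrite !ffunE; case: eqP => // _; rewrite scaler0.
Qed.

Let sum_mu (a : 'I_N -> L) j : \sum_i a i * (mu j == mu i)%:R = a j.
Proof.
rewrite (bigD1 j) //= eqxx mulr1 big1 ?addr0 // => i ij.
by rewrite (inj_eq mu_inj) eq_sym (negPf ij) mulr0.
Qed.

(** The component [w2] lives on dx_1 ... dx_n alone, so it disappears in every degree other than n,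
    and in degree n its coefficients at the [mu i] are the coordinates of the class. The nonzero
    scalar [c] is absorbed in the primitives. *)
Lemma cohomology_of_splitting :
  (forall k : nat, k <> n -> cohomology_vanishes C delta k)
  /\ cohomology_basis C delta n (fun i => top_form n (monomial L (mu i))).
Proof.
split=> [k kn w /split_part[w1 [w2 [w1C w2A ->]]]|].
  suff -> : form_part k w2 = 0 by rewrite addr0; apply: coboundary_part.
  apply/ffunP => S; rewrite !ffunE; case: eqP => // Sk; apply/funext => u.
  apply: w2A; rewrite /basis_index /= -card_setT Sk.
  by rewrite (_ : (k == n) = false) //; apply/eqP.
split=> [i|a|w].
- split=> [S|]; last by rewrite deltaE wedge_diff_top // scaler0.
  by rewrite ffunE card_setT; case: (S == setT) => //; apply: C_mu.
- move=> /(coboundary_gt0 _ _ _ n_gt0)[w1 w1f]; rewrite deltaE -wTZ => h j.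
  have : \sum_i a i *: top_form n (monomial L (mu i)) = 0.
    apply: split_indep h => [S|S u]; first by rewrite ffunE; apply/CZ/(form_C w1f).
    rewrite basis_sum /basis_index /=; case: eqP => //= _ Au; apply: big1 => i _.
    by case: eqP => [uE|_]; rewrite ?mulr0 //; rewrite uE codom_f in Au.
  move=> /ffunP/(_ setT)/(congr1 (fun xi => xi (mu j))).
  by rewrite basis_sum eqxx sum_mu ffunE.
move=> /split_part[w1 [w2 [w1C w2A ->]]]; exists (fun i => w2 setT (mu i)).
suff -> : \sum_(i < N) w2 setT (mu i) *: top_form n (monomial L (mu i)) = form_part n w2.
  by rewrite addrK; apply: coboundary_part.
apply/ffunP => S; apply/funext => u; rewrite basis_sum ffunE card_setT.
case: eqP => // ->; have [/codomP[j ->]|uA] := boolP (u \in codom mu).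
  exact: sum_mu.
rewrite w2A; last by rewrite /basis_index (negPf uA) andbF.
apply: big1 => i _; case: eqP => [uE|_]; rewrite ?mulr0 //.
by rewrite uE codom_f in uA.
Qed.

End CohomologyOfSplitting.

(** As ord pi = 1/(Md) and Mb is a nonnegative integer, which makes the truncation exact, pi^(Mb|u|)
    has valuation (b/d)|u|. *)
Lemma Cb_norm_null (p : nat) (Qp : fieldType) (L : fieldExtType Qp) (ord : L -> rat)
    (n M d : nat) (b : rat) (pi : L) (xi : series L n) :
  padic_valuation p ord -> (0 < M)%N -> (0 < d)%N -> 0 <= b ->
  M%:R * b \is a Num.int -> pi ^+ (M * d) = p%:R ->
  Cb ord M b pi xi <-> norm_null ord (@mdeg n) (b / d%:R) xi.
Proof.
move=> hord M0 d0 b0 Mb_int piE.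
have pi0 : pi != 0.
  apply: contraTneq (p_neq0 hord) => pi0; rewrite -piE pi0 expr0n.
  by rewrite muln_eq0 !eqn0Ngt M0 d0 eqxx.
have M0' : M%:R != 0 :> rat by rewrite pnatr_eq0 -lt0n.
have d0' : d%:R != 0 :> rat by rewrite pnatr_eq0 -lt0n.
have ordpi : ord pi = 1 / (M%:R * d%:R).
  have := congr1 ord piE; rewrite (ordX hord) // (ord_p hord) => h.
  by apply: (canRL (mulfK _)); rewrite ?mulf_neq0 // -natrM mulr_natr.
have BE : (Num.truncn (M%:R * b))%:R = M%:R * b.
  by rewrite truncnK // natrEint Mb_int mulr_ge0 ?ler0n.
set B := Num.truncn _ in BE *.
have ordB k : ord (pi ^+ (B * k)) = b / d%:R * k%:R.
  rewrite (ordX hord) // ordpi -[_ *+ _](mulr_natr _ (B * k)) natrM BE.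
  by field; rewrite M0' d0'.
split=> [[A hA xiE] r|h].
  have [k hk] := hA r; exists k => u /hk ru; rewrite xiE.
  by apply: (ord_geM hord) => //; rewrite -ordB; apply: ord_ge_refl.
exists (fun u => xi u / pi ^+ (B * mdeg u)) => [r|u]; last by rewrite divfK ?expf_neq0.
have [k hk] := h r; exists k => u /hk ru.
rewrite -[r](addrK (b / d%:R * (mdeg u)%:R)); apply: (ord_geM hord) => //.
by right; rewrite (ordV hord) ?expf_neq0 // ordB.
Qed.

Lemma mcoeff_pihomog (R : nzRingType) n d (f : {mpoly R[n]}) m :
  (pihomog mdeg d f)@_m = if mdeg m == d then f@_m else 0.
Proof.
rewrite pihomogE raddf_sum [in RHS](mpolyE f) raddf_sum big_mkcond /=.
case: eqP => md; last first.
  apply: big1_seq => k _; case: eqP => // kd; rewrite mcoeffZ mcoeffX.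
  by case: eqP => [km|_]; rewrite ?mulr0 //; case: md; rewrite -km.
apply: eq_bigr => k _; case: eqP => // kd; rewrite mcoeffZ mcoeffX.
by case: eqP => [km|_]; rewrite ?mulr0 //; case: kd; rewrite km.
Qed.

(** For d = 0 the first derivative is 0, and regularity would put 1 in the zero ideal. *)
Lemma regular_deriv_degree_gt0 (F : fieldType) n d (f : {mpoly F[n]}) : (0 < n)%N ->
  regular_sequence (fun i : 'I_n => (pihomog mdeg d f)^`M(i)) -> (0 < d)%N.
Proof.
case: n f => // n f _ [hreg _]; rewrite lt0n; apply/eqP => d0.
have [|c] := hreg ord0 1.
  exists (fun=> 0); rewrite big_pred0 // mulr1; apply/mpolyP => m.
  by rewrite mcoeff_deriv mcoeff_pihomog d0 mdegD mdeg1 addn1 mul0rn mcoeff0.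
by rewrite big_pred0 // => /eqP; rewrite oner_eq0.
Qed.

(** * Integrality and reduction of the Teichmüller coefficients *)

Section Teichmuller.
Variables (p : nat) (Qp : fieldType) (L : fieldExtType Qp) (ord : L -> rat).
Hypothesis hord : padic_valuation p ord.
Variables (K : {subfield L}) (F : finFieldType) (red : L -> F).
Hypothesis hred : residue_map ord K red.
Variables (n : nat) (f : {mpoly F[n]}) (fhat : {mpoly L[n]}).
Hypothesis hfhat : Teichmuller_lift K red f fhat.

Lemma Teichmuller_lifts u : lifts ord K red fhat@_u f@_u.
Proof.
have [uK uq ur] := hfhat u; split=> //.
exact: (ord_root_unity hord (finNzRing_gt1 F)) uq.
Qed.

Lemma Teichmuller_eq0 u : f@_u = 0 -> fhat@_u = 0.
Proof.
move=> fu; have [uK u0 ur] := Teichmuller_lifts u; have [_ uq _] := hfhat u.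
apply: (ord_root_unity_eq0 hord (finNzRing_gt1 F) uq).
by apply/(red_eq0 hred) => //; rewrite ur.
Qed.

(** The equation x^q = x is preserved by [tau], and it forces integrality. *)
Lemma Teichmuller_Frobenius_int (tau : 'End(L)) l u : kAut 1 K tau ->
  ord_ge ord 0 (iter l tau fhat@_u).
Proof.
rewrite kAutE k1HomE => /andP[/ahom_inP[tauM _] tauK].
have [uK uq _] := hfhat u.
suff [_ E] : iter l tau fhat@_u \in K /\ (iter l tau fhat@_u) ^+ #|F| = iter l tau fhat@_u.
  exact: (ord_root_unity hord (finNzRing_gt1 F)) E.
elim: l => [//|l [IK IE]] /=.
have tK x : x \in K -> tau x \in K by move=> xK; apply: (subvP tauK); apply: memv_img.
split; first exact: tK.
rewrite -{2}IE; have := finNzRing_gt1 F; case: #|F| => // m _.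
elim: m => [|m IH]; first by rewrite !expr1.
by rewrite exprS IH [in RHS]exprS tauM // rpredX.
Qed.

End Teichmuller.

Theorem theorem3p8
  (p a n d : nat) (hp : prime p) (hn : (1 <= n)%N)
  (* F_q and f *)
  (F : finFieldType) (hF : #|F| = (p ^ a)%N)
  (f : {mpoly F[n]}) (hf : msize f = d.+1)
  (* Q_p, K, Omega_1 = Q_p(zeta), Omega_0 = K(zeta), L = Omega_0(pi) *)
  (Qp : fieldType) (L : fieldExtType Qp) (ord : L -> rat)
  (hord : padic_valuation p ord)
  (hQp : is_Qp p (fun c : Qp => ord c%:A))
  (K : {subfield L}) (hKdim : \dim K = a) (hKunr : unramified ord K)
  (red : L -> F) (hred : residue_map ord K red)
  (tau : 'End(L)) (htau : lifts_Frobenius ord K red p tau)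
  (zeta : L) (hzeta : p.-primitive_root zeta)
  (* constants *)
  (b : rat) (hb0 : 0 < b) (hb : b < p%:R / (p%:R - 1))
  (M : nat) (hM : (0 < M)%N)
  (hMb : M%:R * b / p%:R \is a Num.int)
  (hMd : M%:R * d%:R / (p%:R - 1) \is a @Num.int rat)
  (pi : L) (hpi : pi ^+ (M * d) = p%:R)
  (hL : << <<K; zeta>>; pi>>%VS = fullv)
  (eps : nat)
  (heps : eps%:R = M%:R * b * (d%:R - 1) - M%:R * d%:R / (p%:R - 1) :> rat)
  (gamma : L) (hgamma1 : gamma \in <<1; zeta>>%VS)
  (hgamma : ord_cvg ord (gammal p gamma) 0)
  (hgamma0 : gamma != 0) (hgammaord : ord gamma = 1 / (p%:R - 1))
  (* Teichmueller lifting of f *)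
  (fhat : {mpoly L[n]}) (hfhat : Teichmuller_lift K red f fhat)
  (* the partial derivatives of f^(d) diff_form a regular sequence *)
  (hreg : regular_sequence (fun i : 'I_n => (pihomog mdeg d f)^`M(i)))
  (* the monomials x^(mu_i) *)
  (mu : 'I_((d.-1) ^ n) -> 'X_{1..n})
  (hmu : cohomology_basis (fun _ : {mpoly F[n]} => True)
           (wedge_diff (fun i g => (pihomog mdeg d f)^`M(i) * g))
           n (fun i => top_form n 'X_[mu i])) :
  let C : series L n -> Prop := Cb ord M b pi in
  let delta (w : diff_form (series L n) n) : diff_form (series L n) n :=
    pi ^+ eps *: wedge_diff (Dop p gamma tau fhat) w in
  (forall k : nat, k <> n -> cohomology_vanishes C delta k)
  /\ cohomology_basis C delta n (fun i => top_form n (monomial L (mu i))).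
Proof.
move=> C delta.
have d0 := regular_deriv_degree_gt0 hn hreg.
have dq0 : 0 < d%:R :> rat by rewrite ltr0n.
have Mq0 : 0 < M%:R :> rat by rewrite ltr0n.
have pi0 : pi != 0.
  apply: contraTneq (p_neq0 hord) => pi0; rewrite -hpi pi0 expr0n.
  by rewrite muln_eq0 !eqn0Ngt hM d0 eqxx.
have Mb_int : M%:R * b \is a Num.int.
  rewrite -[M%:R * b](divfK (x := p%:R)) ?pnatr_eq0 -?lt0n ?prime_gt0 //.
  by rewrite rpredM // natr_int.
pose beta : rat := b / d%:R.
have CP xi : C xi <-> norm_null ord (@mdeg n) beta xi.
  by apply: (Cb_norm_null _ hord hM d0 (ltW hb0) Mb_int hpi).
have [tau_aut _] := htau.
have fhat_int l m := Teichmuller_Frobenius_int hord hfhat l m tau_aut.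
have fhat_deg m : (d < mdeg m)%N -> fhat@_m = 0.
  move=> md; apply: (Teichmuller_eq0 hord hred hfhat); apply/memN_msupp_eq0/negP.
  by move=> /msize_mdeg_lt; rewrite hf ltnS leqNgt md.
(* This is eps >= 0 divided by M d. *)
have lam_le : 1 / (p%:R - 1) <= beta * d.-1%:R.
  have dE : d.-1%:R = d%:R - 1 :> rat by rewrite -{2}(prednK d0) -natr1 addrK.
  have : 0 <= eps%:R :> rat by apply: ler0n.
  rewrite heps subr_ge0 => h; rewrite -(ler_pM2l (mulr_gt0 Mq0 dq0)) dE /beta.
  have -> : M%:R * d%:R * (b / d%:R * (d%:R - 1)) = M%:R * b * (d%:R - 1).
    by field; rewrite gt_eqF.
  by rewrite mul1r.
have G_homog (i : 'I_n) k : mdeg k != d.-1 -> ((pihomog mdeg d f)^`M(i))@_k = 0.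
  move=> kd; rewrite mcoeff_deriv mcoeff_pihomog mdegD mdeg1 addn1.
  by case: eqP => [E|_]; rewrite ?mul0rn //; rewrite -E eqxx in kd.
have g_homog (i : 'I_n) k : mdeg k != d.-1 -> leading_deriv d fhat i k = 0.
  by rewrite /leading_deriv => /negPf->.
have g_lifts (i : 'I_n) k :
    lifts ord K red (leading_deriv d fhat i k) ((pihomog mdeg d f)^`M(i))@_k.
  rewrite /leading_deriv mcoeff_deriv mcoeff_pihomog mdegD mdeg1 addn1.
  have -> : ((mdeg k).+1 == d) = (mdeg k == d.-1) by rewrite -{1}(prednK d0).
  case: eqP => _; last by rewrite mul0rn; apply: (lifts0 hred).
  rewrite -[X in lifts _ _ _ X _]mulr_natr -[X in lifts _ _ _ _ X]mulr_natr.
  apply: (liftsM hord hred); last exact: (lifts_nat hord hred).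
  exact: (Teichmuller_lifts hord hfhat).
have [h_split h_indep] :=
  series_cohomology hord (fieldExt_ord_complete hord (Qp_complete hQp))
    hKunr hred (gain_gt0 d0 hb0 hb) (gain_le1 p d b) hn G_homog hreg hmu g_lifts g_homog
    (scaled_Dop_linear hp gamma tau fhat) (scaled_Dop_comm hp gamma tau fhat)
    (scaled_Dop_null hp hord hgamma hgamma0 hgammaord fhat_int fhat_deg d0 hb0 hb)
    (scaled_Dop_leading hp hord hgamma hgamma0 hgammaord fhat_int fhat_deg d0 hb0 hb lam_le).
(* The scalar is gamma pi^eps because [scaled_Dop] has divided by gamma. *)
apply: (@cohomology_of_splitting _ _ _ _ _ hn (basis_monomials_inj hn hmu) C _ _ _
  (scaled_Dop p gamma tau fhat) (gamma * pi ^+ eps)).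
- by apply/CP; apply: norm_null0.
- by move=> t xi /CP hxi; apply/CP; apply: (series_scale_null hord).
- move=> i; apply/CP => r; exists (mdeg (mu i)).+1 => u; rewrite /monomial.
  by case: eqP => [->|_ _]; [rewrite ltnn|apply: ord_ge0].
- exact: scaled_Dop_linear.
- by rewrite mulf_neq0 ?expf_neq0.
- move=> w; apply/ffunP => S; rewrite !ffunE !scaler_sumr; apply: eq_bigr => i _.
  rewrite /scaled_Dop !scalerA; congr (_ *: _).
  by rewrite -mulrA [RHS]mulrC; field.
- move=> w wC dw; have [S|w1 [w2 [w1C w2A wE]]] := h_split w _ dw; first exact/CP.
  by exists w1, w2; split=> // S; apply/CP.
- by move=> w1 w2 w1C; apply: h_indep => S; apply/CP.
Qed.
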